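(* Let $\alpha>0$, let $\beta>1$ be fixed, and let $\kappa\in(0,1)$, $\sigma^2>0$ satisfy $(\kappa,\sigma^2)\in R_\beta$, i.e. $$\frac{1}{\sigma^2(1+\beta/\sigma^2)^{1/\beta}}-\frac{1}{\sigma^2+\beta}<\frac{\kappa[(1-\kappa)\beta-1]}{\beta-1}.$$ For each $n$ let $\theta^\star=\theta^{\star,(n)}\in\mathbb{R}^n$ be $s_n$-sparse, where $s_n\to\infty$ and $s_n=o(n)$ as $n\to\infty$, and let $X=(X_1,\ldots,X_n)$ have independent coordinates $X_i\sim\mathsf{N}(\theta_i^\star,1)$. Let $Q_n$ be the empirical Bayes posterior for $\theta$ with parameters $(\alpha,\kappa,\sigma^2)$, put $\varepsilon_n=s_n\log(n/s_n)$, and, for $M>0$, put $$A_{M\varepsilon_n}=\{\theta\in\mathbb{R}^n:\|\theta-\theta^\star\|^2>M\varepsilon_n\}.$$ Then there exists $M>0$ such that $Q_n(A_{M\varepsilon_n})\to 0$ as $n\to\infty$ with $\mathsf{P}_{\theta^\star}$-probability 1.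
   Context: $\|\cdot\|$ is the Euclidean norm on $\mathbb{R}^n$. $\mathsf{N}(\mu,v)$ is the normal distribution with mean $\mu$ and variance $v$. Sparsity. $\theta^\star\in\mathbb{R}^n$ (depending on $n$, deterministic) is called $s_n$-sparse if it has exactly $s_n$ non-zero coordinates. Model. For $\theta\in\mathbb{R}^n$, $p_\theta^n(x)=\prod_{i=1}^n (2\pi)^{-1/2}e^{-(x_i-\theta_i)^2/2}$ is the joint density of independent $X_i\sim\mathsf{N}(\theta_i,1)$, $i=1,\ldots,n$. $\mathsf{P}_{\theta^\star}$ denotes the law of the data when the true mean vectors are $\theta^\star=\theta^{\star,(n)}$; the data vectors for the different $n$ are regarded as defined on a common probability space, so that almost sure statements as $n\to\infty$ make sense. Data-dependent prior (given $X$). $\tilde\Pi_X$ is the distribution of $(\theta,\omega)\in\mathbb{R}^n\times(0,1)$ under which $\omega\sim\mathsf{Beta}(\alpha n,1)$ (density $\alpha n\,\omega^{\alpha n-1}$ on $(0,1)$) and, given $\omega$, the $\theta_i$ are independent with $\theta_i\sim\omega\,\delta_0+(1-\omega)\,\mathsf{N}(X_i,\sigma^2)$, where $\delta_0$ is the point mass at $0$. Its $\theta$-marginal is also written $\tilde\Pi_X(d\theta)$. Empirical Bayes posterior. For measurable $A\subseteq\mathbb{R}^n$, $$Q_n(A)=\frac{\int_A p_\theta^n(X)^\kappa\,\tilde\Pi_X(d\theta)}{\int_{\mathbb{R}^n}p_\theta^n(X)^\kappa\,\tilde\Pi_X(d\theta)}.$$ *)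

(* Defs.v *)
From HB Require Import structures.
From mathcomp Require Import all_boot all_order all_algebra.
From mathcomp Require Import all_classical all_reals all_analysis.
From mathcomp Require Import measurable_realfun.

Set Implicit Arguments.
Unset Strict Implicit.
Unset Printing Implicit Defensive.

Import Order.TTheory GRing.Theory Num.Theory.
Import numFieldNormedType.Exports.

Local Open Scope classical_set_scope.
Local Open Scope ring_scope.

(* R^n is [n.-tuple R], with the product (Borel) sigma-algebra that the library
   puts on tuples. *)

Section euclidean.
Context {R : realType} {n : nat}.

Definition l2dist (u v : n.-tuple R) : R :=
  Num.sqrt (\sum_(i < n) (tnth u i - tnth v i) ^+ 2).

Definition sparse (s : nat) (theta : n.-tuple R) : Prop :=
  #|[set i : 'I_n | tnth theta i != 0%R]%SET| = s.

End euclidean.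

Section independence.
Context {d : measure_display} {T : measurableType d} {R : realType}.

Definition mutually_independent (P : probability T R) (I : finType)
    (X : I -> {RV P >-> R}) : Prop :=
  forall (J : {set I}) (B : I -> set R), (forall i, measurable (B i)) ->
    P (\bigcap_(i in [set` J]) (X i @^-1` B i)) =
    (\prod_(i in J) P (X i @^-1` B i))%E.

End independence.

Section kreparam.
Context {d d1 d2 : measure_display} {Z : measurableType d}
  {X : measurableType d1} {Y : measurableType d2} {R : realType}.

Definition kreparam (f : Z -> X) (mf : measurable_fun [set: Z] f)
  (k : X -> {measure set Y -> \bar R}) (z : Z) : {measure set Y -> \bar R} :=
  k (f z).

Section kernel.
Variables (f : Z -> X) (mf : measurable_fun [set: Z] f).

Let kreparam_measurable (k : R.-ker X ~> Y) U :
  measurable U -> measurable_fun [set: Z] (kreparam mf k ^~ U).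
Proof.
move=> mU.
by apply: (@measurableT_comp _ _ _ _ _ _ (k ^~ U)) => //; exact: measurable_kernel.
Qed.

HB.instance Definition _ (k : R.-ker X ~> Y) :=
  isKernel.Build _ _ _ _ _ (kreparam mf k) (kreparam_measurable k).

Let kreparam_uub (k : R.-fker X ~> Y) : measure_fam_uub (kreparam mf k).
Proof. by have [r kr] := measure_uub k; exists r => z; exact: kr. Qed.

Let kreparam_sfinite (k : R.-sfker X ~> Y) :
  exists2 k_ : (R.-ker Z ~> Y)^nat, forall n, measure_fam_uub (k_ n) &
    forall z U, measurable U -> kreparam mf k z U = mseries (k_ ^~ z) 0 U.
Proof.
have [k_ kE] := sfinite_kernel k.
exists (fun n => kreparam mf (k_ n)); first by move=> n; exact: kreparam_uub.
by move=> z U mU; rewrite /kreparam kE.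
Qed.

HB.instance Definition _ (k : R.-sfker X ~> Y) :=
  isSFiniteKernel_subdef.Build _ _ _ _ _ (kreparam mf k) (kreparam_sfinite k).

End kernel.
End kreparam.

(* [kprod k w] is the product measure of [k 0 w], ..., [k (n - 1) w]; having it
   as a kernel gives its measurability in [w]. *)
Section kprod.
Context {d d' : measure_display} {S : measurableType d}
  {T : measurableType d'} {R : realType}.

Lemma measurable_push n : measurable_fun [set: (S * T) * n.-tuple T]
  (fun z => [the n.+1.-tuple T of z.1.2 :: z.2]).
Proof.
apply: measurable_cons => //.
exact: (measurableT_comp measurable_snd measurable_fst).
Qed.

Fixpoint kprod (n : nat) :
    ('I_n -> R.-sfker S ~> T) -> R.-sfker S ~> n.-tuple T :=
  match n with
  | 0 => fun _ => kdirac (measurable_cst [tuple])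
  | m.+1 => fun k =>
      mkcomp (k ord0)
        (mkcomp (kreparam measurable_fst (kprod (fun i => k (lift ord0 i))))
          (kdirac (measurable_push (n:=m))))
  end.

Lemma kprod_box n (k : 'I_n -> R.-sfker S ~> T) (w : S) (A : 'I_n -> set T) :
  (forall i, measurable (A i)) ->
  kprod k w [set t | forall i, A i (tnth t i)] = (\prod_(i < n) k i w (A i))%E.
Proof.
elim: n k A => [|n IH] k A mA /=.
  rewrite big_ord0 /kdirac/= diracE mem_set//=; last by move=> -[].
rewrite big_ord_recl /kcomp /=.
have E y (t : n.-tuple T) : (forall i, A i (tnth [the n.+1.-tuple T of y :: t] i)) <->
    A ord0 y /\ (forall i, A (lift ord0 i) (tnth t i)).
  split=> [h|[h0 h] i].
    by split=> [|i]; [have := h ord0|have := h (lift ord0 i); rewrite tnthS].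
  by case: (unliftP ord0 i) => [j ->|->]; rewrite ?tnthS.
have mB : measurable [set t : n.-tuple T |
    forall i, A (lift ord0 i) (tnth t i)].
  rewrite (_ : [set _ | _] = \bigcap_(i in [set: 'I_n])
      ((@tnth n T ^~ i) @^-1` A (lift ord0 i))); last first.
    by apply/seteqP; split => t /= h i; [move=> _|]; exact: h.
  apply: fin_bigcap_measurable => // i _.
  by rewrite -[X in measurable X]setTI; apply: measurable_tnth.
transitivity (\int[k ord0 w]_y ((\1_(A ord0) y)%:E *
    kprod (fun i => k (lift ord0 i)) w
      [set t | forall i, A (lift ord0 i) (tnth t i)]))%E.
  apply: eq_integral => y _; rewrite /kreparam/= /kdirac/=.
  rewrite /kcomp /=.
  rewrite -[X in (_ * kprod _ w X)%E]setIT -integral_indic//.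
  rewrite -ge0_integralZl//; last first.
    by apply/measurable_EFinP; exact: measurable_indic.
  apply: eq_integral => t _; rewrite -EFinM !indicE -natrM mulnb; congr (_ %:R%:E).
  congr nat_of_bool; apply/idP/andP.
    by rewrite inE /= => /E [h0 h]; split; rewrite inE.
  by rewrite !inE => -[h0 h]; apply/E.
rewrite ge0_integralZr//; last by apply/measurable_EFinP; exact: measurable_indic.
rewrite integral_indic// setIT.
by rewrite (IH (fun i => k (lift ord0 i)) (fun i => A (lift ord0 i))).
Qed.

End kprod.

Section spike_slab.
Context {R : realType}.

(* The mixing weight is truncated to [0, 1] so that this is a probability for
   every real [w]; it is only used with [0 < w < 1].  The second parameter of
   [normal_prob] is the standard deviation. *)
Definition unit_trunc (w : R) : R := Num.max 0 (Num.min 1 w).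

Definition spike_slab (m v w : R) (A : set R) : \bar R :=
  ((unit_trunc w)%:E * \d_(0%R : R) A +
   (1 - unit_trunc w)%:E * normal_prob m (Num.sqrt v) A)%E.

Lemma unit_trunc_ge0 w : 0 <= unit_trunc w.
Proof. by rewrite /unit_trunc le_max lexx. Qed.

Lemma unit_trunc_le1 w : 0 <= 1 - unit_trunc w.
Proof. by rewrite subr_ge0 /unit_trunc ge_max ler01 ge_min lexx. Qed.

Lemma unit_truncE w : 0 < w < 1 -> unit_trunc w = w.
Proof.
move=> /andP[w0 w1]; rewrite /unit_trunc (min_idPr (ltW w1)).
exact/max_idPr/ltW.
Qed.

Variables (m v : R).

Let spike_slab0 w : spike_slab m v w set0 = 0%E.
Proof. by rewrite /spike_slab !measure0 !mule0 adde0. Qed.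

Let spike_slab_ge0 w A : (0 <= spike_slab m v w A)%E.
Proof.
by rewrite adde_ge0// mule_ge0// lee_fin ?unit_trunc_ge0 ?unit_trunc_le1.
Qed.

Let spike_slab_sigma_additive w : semi_sigma_additive (spike_slab m v w).
Proof.
pose N : {measure set (measurableTypeR R) -> \bar R} :=
  normal_prob m (Num.sqrt v).
pose D : {measure set (measurableTypeR R) -> \bar R} :=
  @dirac _ (measurableTypeR R) 0 R.
pose mu := measure_add (mscale (NngNum (unit_trunc_ge0 w)) D)
  (mscale (NngNum (unit_trunc_le1 w)) N).
have E A : spike_slab m v w A = mu A by rewrite /mu measure_addE.
move=> F mF tF mUF; rewrite E; under eq_cvg do under eq_bigr do rewrite E.
exact: (@measure_semi_sigma_additive _ (measurableTypeR R) R mu F mF tF mUF).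
Qed.

HB.instance Definition _ w := isMeasure.Build _ _ _ (spike_slab m v w)
  (spike_slab0 w) (spike_slab_ge0 w) (@spike_slab_sigma_additive w).

Definition kspike_slab (w : R) : {measure set R -> \bar R} := spike_slab m v w.

Let kspike_slab_measurable U :
  measurable U -> measurable_fun [set: R] (kspike_slab ^~ U).
Proof.
move=> mU.
have mt : measurable_fun [set: R] unit_trunc.
  by apply: measurable_maxr => //; exact: measurable_minr.
apply: emeasurable_funD; apply: emeasurable_funM => //.
  exact/measurable_EFinP.
by apply/measurable_EFinP; exact: measurable_funB.
Qed.

HB.instance Definition _ :=
  isKernel.Build _ _ _ _ _ kspike_slab kspike_slab_measurable.

Let kspike_slab_prob w : kspike_slab w setT = 1%E.
Proof.
rewrite /kspike_slab/= /spike_slab diracT probability_setT !mule1 -EFinD.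
by rewrite addrC subrK.
Qed.

HB.instance Definition _ :=
  Kernel_isProbability.Build _ _ _ _ _ kspike_slab kspike_slab_prob.

End spike_slab.

Section prior.
Context {R : realType} {n : nat}.

Definition beta1_pdf (a w : R) : R := a * w `^ (a - 1).

(* [kprior sigma2 x w] is the law of [(theta, w)] when the weight is [w]. *)
Definition kprior (sigma2 : R) (x : n.-tuple R) :
    R.-sfker R ~> (n.-tuple R * R)%type :=
  mkcomp (kprod (fun i => kspike_slab (tnth x i) sigma2))
    (kdirac (@measurable_swap _ _ R (n.-tuple R))).

Definition eb_joint_prior (alpha : {posnum R}) (sigma2 : R) (x : n.-tuple R)
    (A : set (n.-tuple R * R)) : \bar R :=
  (\int[lebesgue_measure]_(w in `]0%R, 1%R[)
    ((beta1_pdf (alpha%:num * n%:R) w)%:E * kprior sigma2 x w A))%E.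

Variables (alpha : {posnum R}) (sigma2 : R) (x : n.-tuple R).

Let beta1_pdf_ge0 w : 0 <= beta1_pdf (alpha%:num * n%:R) w.
Proof. by rewrite mulr_ge0// powR_ge0. Qed.

Let eb_joint_prior0 : eb_joint_prior alpha sigma2 x set0 = 0%E.
Proof. by apply: integral0_eq => w _; rewrite measure0 mule0. Qed.

Let eb_joint_prior_ge0 A : (0 <= eb_joint_prior alpha sigma2 x A)%E.
Proof. by apply: integral_ge0 => w _; rewrite mule_ge0// lee_fin. Qed.

Let eb_joint_prior_sigma_additive :
  semi_sigma_additive (eb_joint_prior alpha sigma2 x).
Proof.
move=> F mF tF mUF.
have mG k : measurable_fun [set: R] (fun w =>
    ((beta1_pdf (alpha%:num * n%:R) w)%:E * kprior sigma2 x w (F k))%E).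
  apply: emeasurable_funM; last exact: measurable_kernel.
  apply/(measurable_EFinP _ (beta1_pdf _)); apply: measurable_funM => //.
rewrite [X in _ --> X](_ : _ = \int[lebesgue_measure]_(w in `]0%R, 1%R[)
    (\sum_(k <oo) ((beta1_pdf (alpha%:num * n%:R) w)%:E *
      kprior sigma2 x w (F k))))%E; last first.
  apply: eq_integral => w _.
  rewrite nneseriesZl//.
  apply: (congr1 (mule _)).
  by apply/esym/cvg_lim => //; exact/measure_semi_sigma_additive.
rewrite integral_nneseries//; last 2 first.
- move=> k; apply: measurable_funTS; exact: mG.
- by move=> k w _; rewrite mule_ge0// lee_fin.
apply/cvg_closeP; split; last by rewrite closeE.
by apply: is_cvg_nneseries => k _ _; exact: eb_joint_prior_ge0.
Qed.

HB.instance Definition _ := isMeasure.Build _ _ _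
  (eb_joint_prior alpha sigma2 x)
  eb_joint_prior0 eb_joint_prior_ge0 eb_joint_prior_sigma_additive.

Definition eb_prior : set (n.-tuple R) -> \bar R :=
  pushforward (eb_joint_prior alpha sigma2 x) fst.

Let eb_prior0 : eb_prior set0 = 0%E.
Proof. by rewrite /eb_prior /pushforward preimage_set0 measure0. Qed.

Let eb_prior_ge0 A : (0 <= eb_prior A)%E.
Proof. exact: eb_joint_prior_ge0. Qed.

Let eb_prior_sigma_additive : semi_sigma_additive eb_prior.
Proof. by apply: measure_semi_sigma_additive; exact: measurable_fst. Qed.

HB.instance Definition _ := isMeasure.Build _ _ _ eb_prior
  eb_prior0 eb_prior_ge0 eb_prior_sigma_additive.

Lemma eb_joint_prior_box (A : 'I_n -> set R) (B : set R) :
  (forall i, measurable (A i)) -> measurable B ->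
  eb_joint_prior alpha sigma2 x
    ([set theta | forall i, A i (tnth theta i)] `*` B) =
  (\int[lebesgue_measure]_(w in `]0%R, 1%R[)
    ((beta1_pdf (alpha%:num * n%:R) w)%:E * ((\1_B w)%:E *
     \prod_(i < n) (w%:E * \d_(0%R : R) (A i) +
       (1 - w)%:E * normal_prob (tnth x i) (Num.sqrt sigma2) (A i)))))%E.
Proof.
move=> mA mB; apply: eq_integral => w; rewrite inE/= in_itv/= => w01.
apply: (congr1 (mule _)).
pose K := kprod (fun i => kspike_slab (tnth x i) sigma2).
set C := [set theta | _].
transitivity ((\1_B w)%:E * K w C)%E; last first.
  rewrite /K kprod_box//; apply: (congr1 (mule _)); apply: eq_bigr => i _.
  by rewrite /kspike_slab/= /spike_slab unit_truncE.
rewrite /kprior/= /kcomp.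
have mC : measurable C.
  rewrite (_ : C = \bigcap_(i in [set: 'I_n]) ((@tnth n R ^~ i) @^-1` A i)).
    apply: fin_bigcap_measurable => // i _.
    by rewrite -[X in measurable X]setTI; apply: measurable_tnth.
  by apply/seteqP; split => t /= h i; [move=> _|]; exact: h.
rewrite -[X in (_ * K w X)%E]setIT -integral_indic//.
rewrite -ge0_integralZl//; last by apply/measurable_EFinP; exact: measurable_indic.
apply: eq_integral => t _; rewrite /kdirac/= diracE -EFinM !indicE -natrM mulnb.
congr (_ %:R%:E); congr nat_of_bool; apply/idP/andP.
  by rewrite inE /= => -[Ct Bw]; split; rewrite inE.
by rewrite !inE => -[Bw Ct].
Qed.

End prior.

Section posterior.
Context {R : realType} {n : nat}.

Definition likelihood (theta x : n.-tuple R) : R :=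
  \prod_(i < n) normal_pdf (tnth theta i) 1 (tnth x i).

Definition eb_posterior (alpha : {posnum R}) (kappa sigma2 : R)
    (x : n.-tuple R) (A : set (n.-tuple R)) : R :=
  (\int[eb_prior alpha sigma2 x]_(theta in A) (likelihood theta x `^ kappa)) /
  (\int[eb_prior alpha sigma2 x]_theta (likelihood theta x `^ kappa)).

End posterior.

Definition region_R {R : realType} (beta kappa sigma2 : R) : Prop :=
  (sigma2 * (1 + beta / sigma2) `^ beta^-1)^-1 - (sigma2 + beta)^-1 <
  kappa * ((1 - kappa) * beta - 1) / (beta - 1).

(* Main.v *)
Require Import Defs.
From mathcomp Require Import all_boot all_order all_algebra.
From mathcomp Require Import all_classical all_reals all_analysis.
From mathcomp Require Import measurable_realfun.
From mathcomp Require Import ring lra.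
Import Order.TTheory GRing.Theory Num.Theory.
Import numFieldNormedType.Exports.
Local Open Scope classical_set_scope.
Local Open Scope ring_scope.

(** Given the weight [w] everything factorises over the coordinates.  For a small
    [t > 0], Markov's inequality for [exp (t * |theta - theta*|^2)] bounds the
    numerator of [Q_n] on the bad set by [exp (- t * M * eps_n)] times an integral
    over [w] of explicit one-coordinate factors.  The denominator is bounded below
    by keeping only the slab on the support of [theta*] and only the spike off it.
    After division by the common factor [prod_i null_scale], the remaining factor
    at a null coordinate is
      [w + (1 - w) * (1 + (kappa - 4 t) sigma2)^(-1/2) *
         exp ((kappa / 2 + 2 t) * X_i^2)],
    whose expectation is at most [1] for small [t] as soon as
    [1 < sigma2 * (1 - kappa)]; this is where [region_R] enters.  The factors on
    the support have expectation at most [2].  Hence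
    [E Q_n <= exp (- 2 eps_n) <= n^-2] for large [M], and the expectations being
    summable, [Q_n] tends to [0] almost surely. *)

(** * Integration against mixtures of measures, and factorisation over coordinates *)

Section mixtures.
Set Implicit Arguments.
Unset Strict Implicit.
Import HBNNSimple.
Local Open Scope ereal_scope.

Lemma prode_ge0 (R : realType) (I : Type) (r : seq I) (Q : pred I)
    (f : I -> \bar R) : (forall i, Q i -> 0 <= f i) ->
  0 <= \prod_(i <- r | Q i) f i.
Proof. by move=> f0; elim/big_ind : _ => // x y; exact: mule_ge0. Qed.

Lemma lee_prod (R : realType) (I : Type) (r : seq I) (Q : pred I)
    (f g : I -> \bar R) : (forall i, Q i -> 0 <= f i <= g i) ->
  \prod_(i <- r | Q i) f i <= \prod_(i <- r | Q i) g i.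
Proof.
move=> fg; have f0 i : Q i -> 0 <= f i by move=> /fg/andP[].
elim: r => [|i r IH]; first by rewrite !big_nil.
rewrite !big_cons; case: ifPn => // Qi; have /andP[fi fgi] := fg _ Qi.
by apply: lee_pmul => //; exact: prode_ge0.
Qed.

Lemma prod_EFin (R : realType) (I : Type) (r : seq I) (Q : pred I) (f : I -> R) :
  (\prod_(i <- r | Q i) (f i)%:E = (\prod_(i <- r | Q i) f i)%R%:E)%E.
Proof.
elim: r => [|i r IH]; rewrite ?big_nil// !big_cons; case: ifP => // _.
by rewrite IH EFinM.
Qed.

Lemma emeasurable_prod (d : measure_display) (T : measurableType d)
    (R : realType) (I : Type) (r : seq I) (Q : pred I) (f : I -> T -> \bar R) :
  (forall i, measurable_fun [set: T] (f i)) ->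
  measurable_fun [set: T] (fun x => \prod_(i <- r | Q i) f i x).
Proof.
move=> mf; elim: r => [|i r IH].
  by under eq_fun do rewrite big_nil; exact: measurable_cst.
under eq_fun do rewrite big_cons; case: (Q i) => //.
exact: emeasurable_funM.
Qed.

(** Continuity covers finite [c]. For [c = +oo] both sides are [0] when [u] vanishes identically,
    and otherwise both are [+oo], since [c * u n = +oo] from the first positive term on. *)
Lemma lim_mule_nd (R : realType) (c : \bar R) (u : (\bar R)^nat) :
  0 <= c -> (forall n, 0 <= u n) -> nondecreasing_seq u ->
  c * lim (u @ \oo) = lim ((c * u n) @[n --> \oo]).
Proof.
move=> c0 u0 ndu; have cu := ereal_nondecreasing_is_cvgn ndu.
have ule n : u n <= lim (u @ \oo).
  by rewrite (cvg_lim _ (ereal_nondecreasing_cvgn ndu))//; exact: ereal_sup_ubound.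
have [cfin|] := boolP (c \is a fin_num); first by rewrite limeMl.
rewrite ge0_fin_numE// -leNgt leye_eq => /eqP ->.
have [/eqP u00|] := boolP (`[< forall n, u n = 0 >]).
  move: u00 => /eqP/asboolP u00.
  have -> : u = cst 0 by apply/funext.
  under [in RHS]eq_fun do rewrite mule0.
  by rewrite !(cvg_lim _ (cvg_cst 0))// mule0.
move=> /asboolPn/existsNP[m /eqP um].
have um0 : 0 < u m by rewrite lt0e um u0.
rewrite gt0_mulye; last exact: lt_le_trans (ule m).
apply/esym/cvg_lim => //; apply: cvg_near_cst; exists m => // n /= mn.
by rewrite gt0_mulye// (lt_le_trans um0)// ndu.
Qed.

(** Simple functions increase to [g], and monotone convergence applies first under [K t], then under
    [nu]. The right-hand side sees [nu], [c] and [K] only through the integrals of [c t * K t B], so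
    two mixtures can be compared on sets. *)
Lemma integral_mixture_approx (R : realType) (d d' : measure_display)
    (T : measurableType d) (Y : measurableType d')
    (nu : {measure set T -> \bar R}) (D : set T) (c : T -> \bar R)
    (K : T -> {measure set Y -> \bar R}) (g : Y -> \bar R)
    (mg : measurable_fun [set: Y] g) :
  measurable D -> (forall t, 0 <= c t) -> measurable_fun [set: T] c ->
  (forall B, measurable B -> measurable_fun [set: T] (K ^~ B)) ->
  (forall y, 0 <= g y) ->
  \int[nu]_(t in D) (c t * \int[K t]_y g y) =
  lim ((\sum_(r \in range (nnsfun_approx measurableT mg n))
    r%:E * \int[nu]_(t in D)
      (c t * K t (nnsfun_approx measurableT mg n @^-1` [set r])))
   @[n --> \oo]).
Proof.
move=> mD c0 mc mK g0.
have mD' (f : T -> \bar R) : measurable_fun [set: T] f -> measurable_fun D f.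
  exact: measurable_funTS.
set h := nnsfun_approx measurableT mg.
have h0 n y : 0 <= (h n y)%:E by rewrite lee_fin.
have mh n : measurable_fun [set: Y] (fun y => (h n y)%:E).
  exact/measurable_EFinP.
have hle y a b : (a <= b)%N -> (h a y)%:E <= (h b y)%:E.
  by move=> ab; rewrite lee_fin; exact/lefP/nd_nnsfun_approx.
transitivity (\int[nu]_(t in D)
    lim ((c t * \int[K t]_y (h n y)%:E) @[n --> \oo])).
  apply: eq_integral => t _.
  transitivity (c t * \int[K t]_y (lim ((h n y)%:E @[n --> \oo]))).
    congr (_ * _); apply: eq_integral => y _; apply/esym/cvg_lim => //.
    exact: cvg_nnsfun_approx.
  rewrite monotone_convergence//; last by move=> y _ a b; exact: hle.
  apply: lim_mule_nd => //.
    by move=> n; exact: integral_ge0.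
  by move=> a b ab; apply: ge0_le_integral => // y _; exact: hle.
rewrite monotone_convergence//; last 3 first.
- move=> n; apply: mD'; apply: emeasurable_funM => //.
  exact: measurable_fun_integral_kernel.
- by move=> n t _; rewrite mule_ge0// integral_ge0.
- move=> t _ a b ab; rewrite lee_wpmul2l//.
  by apply: ge0_le_integral => // y _; exact: hle.
congr (lim (_ @ \oo)); apply: funext => n.
have indic0 (r : R) y : 0 <= (r * \1_(h n @^-1` [set r]) y)%:E.
  exact: nnfun_muleindic_ge0.
have mr r : measurable (h n @^-1` [set r]) by [].
transitivity (\int[nu]_(t in D) (\sum_(r \in range (h n))
    (r%:E * (c t * K t (h n @^-1` [set r]))))).
  apply: eq_integral => t _.
  under eq_integral do rewrite fimfunE -fsumEFin//.
  rewrite ge0_integral_fsum//; last first.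
    by move=> r; apply/measurable_EFinP/measurable_funM.
  rewrite ge0_mule_fsumr; last by move=> r; exact: integral_ge0.
  apply: eq_fsbigr => r _.
  rewrite (integralZl_indic _ (fun r => h n @^-1` [set r]))//; last first.
    exact: preimage_nnfun0.
  by rewrite integral_indic// setIT muleCA.
have cK0 r t : 0 <= r%:E * (c t * K t (h n @^-1` [set r])).
  have [r0|r0] := leP 0%R r; first by rewrite !mule_ge0.
  by rewrite preimage_nnfun0// measure0 !mule0.
have mcK r : measurable_fun [set: T] (fun t => c t * K t (h n @^-1` [set r])).
  by apply: emeasurable_funM => //; exact: mK.
rewrite ge0_integral_fsum//; last first.
  by move=> r; apply: mD'; apply: emeasurable_funM => //; exact: mcK.
apply: eq_fsbigr => r _.
(* A negative [r] is not a value of the simple function: its level set is empty and both sides are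
   [0]. *)
have [r0|r0] := leP 0%R r.
  rewrite ge0_integralZl//; first by apply: mD'; exact: mcK.
  by move=> t _; rewrite mule_ge0.
rewrite preimage_nnfun0// [X in _ = _ * X]integral0_eq ?mule0.
  by rewrite integral0_eq// => t _; rewrite measure0 !mule0.
by move=> t _; rewrite measure0 mule0.
Qed.

(* No finiteness is assumed, so uniqueness of measures does not apply; both sides
   are monotone limits of the same combinations of their values on indicators. *)
Lemma eq_integral_mixture (R : realType) (d1 d2 d' : measure_display)
    (T1 : measurableType d1) (T2 : measurableType d2) (Y : measurableType d')
    (nu1 : {measure set T1 -> \bar R}) (nu2 : {measure set T2 -> \bar R})
    (D1 : set T1) (D2 : set T2) (c1 : T1 -> \bar R) (c2 : T2 -> \bar R)
    (K1 : T1 -> {measure set Y -> \bar R}) (K2 : T2 -> {measure set Y -> \bar R})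
    (g : Y -> \bar R) :
  measurable D1 -> (forall t, 0 <= c1 t) -> measurable_fun [set: T1] c1 ->
  (forall B, measurable B -> measurable_fun [set: T1] (K1 ^~ B)) ->
  measurable D2 -> (forall t, 0 <= c2 t) -> measurable_fun [set: T2] c2 ->
  (forall B, measurable B -> measurable_fun [set: T2] (K2 ^~ B)) ->
  measurable_fun [set: Y] g -> (forall y, 0 <= g y) ->
  (forall B, measurable B -> \int[nu1]_(t in D1) (c1 t * K1 t B) =
                             \int[nu2]_(t in D2) (c2 t * K2 t B)) ->
  \int[nu1]_(t in D1) (c1 t * \int[K1 t]_y g y) =
  \int[nu2]_(t in D2) (c2 t * \int[K2 t]_y g y).
Proof.
move=> mD1 c10 mc1 mK1 mD2 c20 mc2 mK2 mg g0 E.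
rewrite (integral_mixture_approx nu1 mg)// (integral_mixture_approx nu2 mg)//.
congr (lim (_ @ \oo)); apply: funext => n.
by apply: eq_fsbigr => r _; rewrite E.
Qed.

(* By induction on the number [k] of leading coordinates whose [g i] is not an
   indicator, turning one indicator at a time into a general function. *)
Lemma integral_prod_mixture (R : realType) (d d' dy : measure_display)
    (T : measurableType d) (W : measurableType d') (V : measurableType dy) (n : nat)
    (nu : {measure set T -> \bar R}) (rho : {measure set W -> \bar R})
    (D : set W) (b : W -> \bar R) (Y : 'I_n -> T -> V)
    (K : 'I_n -> W -> {measure set V -> \bar R}) (g : 'I_n -> V -> \bar R) :
  measurable D -> (forall w, 0 <= b w) -> measurable_fun [set: W] b ->
  (forall i B, measurable B -> measurable_fun [set: W] (K i ^~ B)) ->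
  (forall i, measurable_fun [set: T] (Y i)) ->
  (forall i, measurable_fun [set: V] (g i)) -> (forall i y, 0 <= g i y) ->
  (forall B : 'I_n -> set V, (forall i, measurable (B i)) ->
    nu [set t | forall i, B i (Y i t)] =
    \int[rho]_(w in D) (b w * \prod_(i < n) K i w (B i))) ->
  \int[nu]_t \prod_(i < n) g i (Y i t) =
  \int[rho]_(w in D) (b w * \prod_(i < n) \int[K i w]_y g i y).
Proof.
move=> mD b0 mb mK mY mg g0 box.
(* For [k >= n] the indicator condition on the coordinates from [k] on is vacuous, so the induction,
   general in [g], gives the claim. *)
have [k kn] : {k | (n <= k)%N} by exists n.
have : forall i : 'I_n, (k <= i)%N ->
    exists2 B, measurable B & g i = fun y => (\1_B y)%:E.
  by move=> i /(leq_trans kn); rewrite leqNgt ltn_ord.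
elim: k {kn} g mg g0 => [|k IH] g mg g0 gk.
  have /choice[B HB] : forall i : 'I_n, exists B,
      measurable B /\ g i = fun y => (\1_B y)%:E.
    by move=> i; have [B mB ->] := gk i (leq0n _); exists B.
  have mB i : measurable (B i) by case: (HB i).
  have gE i : g i = fun y => (\1_(B i) y)%:E by case: (HB i).
  transitivity (\int[nu]_t (\1_[set t | forall i, B i (Y i t)] t)%:E).
    apply: eq_integral => t _.
    under eq_bigr do rewrite gE.
    rewrite prod_EFin; congr EFin; rewrite indicE.
    have [/set_mem/= h|] := boolP (t \in _).
      by rewrite big1// => i _; rewrite indicE mem_set.
    rewrite notin_setE/= => /existsNP[i hi].
    by rewrite (bigD1 i)//= indicE memNset ?mul0r.
  rewrite integral_indic ?setIT ?box//; last first.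
    rewrite (_ : [set _ | _] = \bigcap_(i in [set: 'I_n]) (Y i @^-1` B i)).
      apply: fin_bigcap_measurable => // i _.
      by rewrite -[X in measurable X]setTI; exact: mY.
    by apply/seteqP; split => t /= h i; [move=> _|]; exact: h.
  apply: eq_integral => w _; congr (_ * _); apply: eq_bigr => i _.
  by rewrite gE integral_indic// setIT.
have [kn|kn] := leqP n k.
  by apply: IH => // i /(leq_trans kn); rewrite leqNgt ltn_ord.
pose j := Ordinal kn.
have mgY i : measurable_fun [set: T] (fun t => g i (Y i t)).
  exact: (measurableT_comp (mg i) (mY i)).
have mKg i : measurable_fun [set: W] (fun w => \int[K i w]_y g i y).
  by apply: measurable_fun_integral_kernel => //; exact: mK.
(* All factors but the [j]-th become weights. What remains is a comparison of two mixtures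
   integrating [g j] alone, with kernels the Dirac mass at [Y j t] and [K j w]. *)
pose c1 t := \prod_(i < n | i != j) g i (Y i t).
pose c2 w := b w * \prod_(i < n | i != j) \int[K i w]_y g i y.
have c10 t : 0 <= c1 t by exact: prode_ge0.
have c20 w : 0 <= c2 w.
  by rewrite mule_ge0// prode_ge0// => i _; exact: integral_ge0.
have mc1 : measurable_fun [set: T] c1 by exact: emeasurable_prod.
have mc2 : measurable_fun [set: W] c2.
  by apply: emeasurable_funM => //; exact: emeasurable_prod.
transitivity (\int[nu]_t (c1 t * \int[kdirac (mY j) t]_y g j y)).
  apply: eq_integral => t _; rewrite (bigD1 j)//= muleC; congr (_ * _).
  by rewrite /kdirac/= integral_dirac// diracT mul1e.
transitivity (\int[rho]_(w in D) (c2 w * \int[K j w]_y g j y)); last first.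
  by apply: eq_integral => w _; rewrite (bigD1 j)//= muleCA muleC.
apply: eq_integral_mixture => //.
- by move=> B mB; exact: measurable_kernel.
- by move=> B mB; exact: mK.
move=> B mB.
(* Testing the two mixtures on a set [B] amounts to replacing [g j] by an indicator, where the
   induction hypothesis applies. *)
pose g' i := if i == j then fun y => (\1_B y)%:E else g i.
have mg' i : measurable_fun [set: V] (g' i).
  by rewrite /g'; case: ifP => // _; apply/measurable_EFinP/measurable_indic.
have g'0 i y : 0 <= g' i y.
  by rewrite /g'; case: ifP => // _; rewrite lee_fin.
have := IH g' mg' g'0; set P := (X in (X -> _) -> _).
have HP : P.
  move=> i ki; rewrite /g'; case: ifPn => [_|ij]; first by exists B.
  apply: gk; rewrite ltn_neqAle ki andbT; apply: contra ij => /eqP ki'.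
  by apply/eqP/val_inj.
move=> /(_ HP) => {P HP} E.
transitivity (\int[nu]_t \prod_(i < n) g' i (Y i t)).
  apply: eq_integral => t _; rewrite (bigD1 j)//= muleC; congr (_ * _).
    by rewrite /g' eqxx /kdirac/= diracE indicE.
  by apply: eq_bigr => i /negbTE ij; rewrite /g' ij.
rewrite E; apply: eq_integral => w _; rewrite (bigD1 j)//= muleCA muleC.
congr (_ * _); last by rewrite /g' eqxx integral_indic// setIT.
by congr (_ * _); apply: eq_bigr => i /negbTE ij; rewrite /g' ij.
Qed.
End mixtures.

(** * From [region_R] to the condition [1 < sigma2 * (1 - kappa)] *)

Section concentration.
Set Implicit Arguments.
Unset Strict Implicit.

(** Concavity of [ln] between [1 + b * u] and [1] with weight [b^-1] on the former: the convex
    combination is [1 + u]. *)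
Lemma powR_invr_le1D (R : realType) (b u : R) :
  1 < b -> 0 < u -> (1 + b * u) `^ b^-1 <= 1 + u.
Proof.
move=> b1 u0; have b0 : 0 < b by lra.
have bu0 : 0 < 1 + b * u by have := mulr_gt0 b0 u0; lra.
have bV : 0 <= b^-1 <= 1 by rewrite invr_ge0 ltW//= invf_le1// ltW.
have [b00 b01] := andP bV.
have := @concave_ln R (Itv01 b00 b01) (1 + b * u) 1 bu0 ltr01.
rewrite !convRE/= ln1 mulr0 addr0 mulr1 mulrDr mulr1 mulKf ?gt_eqF//.
rewrite (_ : _ + unstable.onem _ = 1 + u); last by rewrite /unstable.onem; ring.
move=> h; rewrite /powR gt_eqF// -ler_ln ?posrE ?expR_gt0 ?expRK//; lra.
Qed.

(* With [u = 1 / sigma2]: if [(b - 1) / (2 b) <= 1 - u], the quadratic in [k] is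
   decreasing on [k >= 1 - u] and the case [k = 1 - u] reduces to
   [0 <= (1 - b * u ^+ 2) ^+ 2]; otherwise its maximum value is used. *)
Lemma region_poly (R : realFieldType) (b k u : R) :
  1 < b -> 0 < k -> 0 < u -> 1 - k <= u ->
  k * ((1 - k) * b - 1) * ((1 + u) * (1 + b * u)) <= (b - 1) ^+ 2 * u ^+ 2.
Proof.
move=> b1 k0 u0 ku.
have b0 : 0 < b by lra.
have bu0 : 0 < b * u by exact: mulr_gt0.
have P0 : 0 < (1 + u) * (1 + b * u) by apply: mulr_gt0; lra.
have [h|h] := leP (b - 1) (2 * b * (1 - u)).
  have f_le : k * ((1 - k) * b - 1) <= (1 - u) * (u * b - 1).
    rewrite -subr_ge0.
    have -> : (1 - u) * (u * b - 1) - k * ((1 - k) * b - 1) =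
      (k - (1 - u)) * (b * (k - (1 - u)) + (2 * b * (1 - u) - (b - 1))) by ring.
    have k1 : 0 <= k - (1 - u) by lra.
    have := mulr_ge0 (ltW b0) k1 => k2.
    by apply: mulr_ge0 => //; lra.
  apply: (le_trans (ler_wpM2r (ltW P0) f_le)); rewrite -subr_ge0.
  have -> : (b - 1) ^+ 2 * u ^+ 2 -
    (1 - u) * (u * b - 1) * ((1 + u) * (1 + b * u)) = (1 - b * u ^+ 2) ^+ 2 by ring.
  exact: sqr_ge0.
have f_le : 4 * b * (k * ((1 - k) * b - 1)) <= (b - 1) ^+ 2.
  rewrite -subr_ge0.
  have -> : (b - 1) ^+ 2 - 4 * b * (k * ((1 - k) * b - 1)) =
    (b - 1 - 2 * k * b) ^+ 2 by ring.
  exact: sqr_ge0.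
(* In this case [b + 1 < 2 * b * u], and [4 * b <= (b + 1) ^+ 2]. The two facts also bound each term
   of the expanded product [(1 + u) * (1 + b * u)] by a multiple of [b * u ^+ 2]. *)
have bu2 : 1 <= b * u ^+ 2.
  rewrite -(@ler_pM2l _ (4 * b)); last by lra.
  have -> : 4 * b * (b * u ^+ 2) = (2 * b * u) ^+ 2 by ring.
  have : (b + 1) ^+ 2 <= (2 * b * u) ^+ 2 by rewrite ler_sqr ?nnegrE; lra.
  by have := sqr_ge0 (b - 1); nra.
have P_le : (1 + u) * (1 + b * u) <= 4 * b * u ^+ 2.
  have : u * (b + 1) <= u * (2 * b * u) by rewrite ler_pM2l//; lra.
  by nra.
rewrite -(@ler_pM2l _ (4 * b)); last by lra.
rewrite [leLHS]mulrA; apply: (le_trans (ler_wpM2r (ltW P0) f_le)).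
have -> : 4 * b * ((b - 1) ^+ 2 * u ^+ 2) = (b - 1) ^+ 2 * (4 * b * u ^+ 2) by ring.
by rewrite ler_wpM2l ?sqr_ge0.
Qed.

(** With [u = 1 / sigma2], [powR_invr_le1D] bounds the left side of [region_R] below by a rational
    function of [u]. If the conclusion failed, then [1 - kappa <= u], and [region_poly] would
    contradict the strict inequality. *)
Lemma region_R_slab (R : realType) (beta kappa sigma2 : R) :
  1 < beta -> 0 < kappa -> kappa < 1 -> 0 < sigma2 ->
  region_R beta kappa sigma2 -> 1 < sigma2 * (1 - kappa).
Proof.
move=> b1 k0 k1 s0; rewrite /region_R.
pose u := sigma2^-1.
have u0 : 0 < u by rewrite invr_gt0.
have b0 : 0 < beta by lra.
have bu0 : 0 < beta * u by exact: mulr_gt0.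
have sE : sigma2 = u^-1 by rewrite invrK.
have p0 : 0 < (1 + beta * u) `^ beta^-1 by apply: powR_gt0; lra.
have pu := powR_invr_le1D b1 u0.
have h1 : (sigma2 * (1 + beta * u) `^ beta^-1)^-1 >= u / (1 + u).
  rewrite invfM -/u ler_pM2l// lef_pV2// posrE; lra.
have h2 : (sigma2 + beta)^-1 = u / (1 + beta * u).
  by rewrite sE; field; rewrite !gt_eqF//; lra.
rewrite -/u h2 => reg.
have {h1 h2}reg : u / (1 + u) - u / (1 + beta * u) <
    kappa * ((1 - kappa) * beta - 1) / (beta - 1) by lra.
rewrite ltNge; apply/negP => ks.
have uk : 1 - kappa <= u.
  by rewrite -(ler_pM2l s0) divff ?gt_eqF.
move: reg; apply/negP; rewrite -leNgt.
have -> : u / (1 + u) - u / (1 + beta * u) =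
    (beta - 1) * u ^+ 2 / ((1 + u) * (1 + beta * u)).
  by field; rewrite !gt_eqF//; lra.
rewrite ler_pdivrMr; last lra.
rewrite mulrAC ler_pdivlMr; last by apply: mulr_gt0; lra.
rewrite [leRHS](_ : _ = (beta - 1) ^+ 2 * u ^+ 2); last by ring.
exact: region_poly.
Qed.

(** * Integrals under normal, spike-and-slab and prior laws *)

(** The normal law is the mixture of Dirac masses weighted by its density; [eq_integral_mixture]
    compares it with a mixture over one point. *)
Lemma integral_normal_prob (R : realType) (m s : R) (g : R -> \bar R) :
  measurable_fun [set: R] g -> (forall y, (0 <= g y)%E) ->
  (\int[normal_prob m s]_y g y =
   \int[lebesgue_measure]_y ((normal_pdf m s y)%:E * g y))%E.
Proof.
move=> mg g0.
transitivity (\int[\d_tt]_(t in [set: unit]) (1 * \int[normal_prob m s]_y g y))%E.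
  by rewrite integral_dirac// diracT !mul1e.
transitivity (\int[lebesgue_measure]_(t in [set: R])
    ((normal_pdf m s t)%:E *
      \int[kdirac (@measurable_id _ (measurableTypeR R) setT) t]_y g y))%E;
  last first.
  apply: eq_integral => t _; congr (_ * _)%E.
  by rewrite /kdirac/= integral_dirac// diracT mul1e.
have mpdf : measurable_fun [set: R] (fun t => (normal_pdf m s t)%:E).
  by apply/measurable_EFinP; exact: measurable_normal_pdf.
pose N : {measure set (measurableTypeR R) -> \bar R} := normal_prob m s.
refine (@eq_integral_mixture R _ _ _ unit _ _ \d_tt lebesgue_measure setT setT
  (fun=> 1%E) (fun t => (normal_pdf m s t)%:E) (fun=> N)
  (kdirac (@measurable_id _ (measurableTypeR R) setT)) g _ _ _ _ _ _ _ _ _ _ _) => //.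
- by move=> t; rewrite lee_fin normal_pdf_ge0.
- by move=> B mB; exact: measurable_kernel.
move=> B mB; rewrite integral_dirac// diracT !mul1e.
rewrite [LHS]integral_mkcond; apply: eq_integral => t _.
rewrite /kdirac/= diracE patchE; case: ifPn; rewrite ?mule1 ?mule0//.
Qed.

(** With [q] the square root on the right, the integrand times the density is [q^-1] times the
    normal density of standard deviation [s / q]. A negative [b] is allowed, which gives the
    exponential moments of a squared Gaussian. *)
Lemma integral_normal_prob_gauss (R : realType) (m s b : R) :
  s != 0 -> 0 < 1 + b * s ^+ 2 ->
  (\int[normal_prob m s]_y (expR (- (b * (y - m) ^+ 2 / 2)))%:E =
   ((Num.sqrt (1 + b * s ^+ 2))^-1)%:E)%E.
Proof.
move=> s0 b0.
have s20 : 0 < s ^+ 2 by rewrite exprn_even_gt0.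
rewrite integral_normal_prob//; last first.
  apply/measurable_EFinP; apply: measurableT_comp => //.
  apply: measurableT_comp => //; apply: measurable_funM => //.
  apply: measurable_funM => //; apply: measurable_funX => //.
  exact: measurable_funB.
set q := Num.sqrt (1 + b * s ^+ 2).
have q0 : 0 < q by rewrite sqrtr_gt0.
have q2 : q ^+ 2 = 1 + b * s ^+ 2 by rewrite sqr_sqrtr// ltW.
pose s' := s / q.
have s'0 : s' != 0 by rewrite mulf_neq0// invr_neq0// gt_eqF.
transitivity (\int[lebesgue_measure]_y (q^-1%:E * (normal_pdf m s' y)%:E))%E.
  apply: eq_integral => y _; rewrite -!EFinM !normal_pdfE//; congr EFin.
  rewrite /normal_fun -[LHS]mulrA -expRD [RHS]mulrA; congr (_ * expR _).
    have e : s ^+ 2 * pi *+ 2 = q ^+ 2 * (s' ^+ 2 * pi *+ 2).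
      by rewrite /s' expr_div_n; field; exact: lt0r_neq0.
    by rewrite /normal_peak e sqrtrM ?sqr_ge0// sqrtr_sqr ger0_norm ?(ltW q0)// invfM.
  rewrite /s' expr_div_n q2; field; rewrite s0 andbT; exact: lt0r_neq0.
rewrite ge0_integralZl//; last first.
- by rewrite lee_fin invr_ge0 ltW.
- by move=> y _; rewrite lee_fin normal_pdf_ge0.
- by apply/measurable_EFinP; exact: measurable_normal_pdf.
by rewrite integral_normal_pdf mule1.
Qed.

(* [measurableTypeR R] and the default measurable structure on [R] carry different
   displays, so integrals over them are not convertible. *)
Lemma eq_measure_integral_display (R : realType)
    (mu : {measure set (measurableTypeR R) -> \bar R}) (nu : {measure set R -> \bar R})
    (g : R -> \bar R) :
  measurable_fun [set: R] g -> (forall y, (0 <= g y)%E) ->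
  (forall A : set R, measurable A -> mu A = nu A) ->
  (\int[mu]_y g y = \int[nu]_y g y)%E.
Proof.
move=> mg g0 E.
pose idR : measurableTypeR R -> R := idfun.
have mid : measurable_fun [set: measurableTypeR R] idR by exact: measurable_id.
rewrite -(@ge0_integral_pushforward _ _ (measurableTypeR R) R R idR mid mu setT g)//.
by apply: eq_measure_integral => A mA _; exact: E.
Qed.

Lemma integral_spike_slab (R : realType) (m v w : R) (g : R -> \bar R) :
  0 < w < 1 -> measurable_fun [set: R] g -> (forall y, (0 <= g y)%E) ->
  (\int[kspike_slab m v w]_y g y =
   w%:E * g 0%R + (1 - w)%:E * \int[normal_prob m (Num.sqrt v)]_y g y)%E.
Proof.
move=> w01 mg g0.
pose N : {measure set (measurableTypeR R) -> \bar R} :=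
  normal_prob m (Num.sqrt v).
pose D : {measure set (measurableTypeR R) -> \bar R} :=
  @dirac _ (measurableTypeR R) 0 R.
pose mu : {measure set (measurableTypeR R) -> \bar R} := measure_add
  (mscale (NngNum (unit_trunc_ge0 w)) D)
  (mscale (NngNum (unit_trunc_le1 w)) N).
transitivity (\int[mu]_y g y)%E.
  apply/esym/eq_measure_integral_display => // A mA.
  exact: measure_addE.
rewrite ge0_integral_measure_add// !ge0_integral_mscale//=.
by rewrite unit_truncE// integral_dirac// diracT mul1e.
Qed.

(** Given the weight, the coordinates are independent: this is [integral_prod_mixture] with
    [kspike_slab] as kernels, its condition on boxes being [eb_joint_prior_box] with the weight
    unrestricted. *)
Lemma integral_eb_prior (R : realType) (n : nat) (alpha : {posnum R}) (sigma2 : R)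
    (x : n.-tuple R) (g : 'I_n -> R -> \bar R) :
  (forall i, measurable_fun [set: R] (g i)) -> (forall i y, (0 <= g i y)%E) ->
  (\int[eb_prior alpha sigma2 x]_theta \prod_(i < n) g i (tnth theta i) =
   \int[lebesgue_measure]_(w in `]0%R, 1%R[)
     ((beta1_pdf (alpha%:num * n%:R) w)%:E * \prod_(i < n)
       (w%:E * g i 0%R + (1 - w)%:E *
        \int[normal_prob (tnth x i) (Num.sqrt sigma2)]_y g i y)))%E.
Proof.
move=> mg g0.
rewrite (@integral_prod_mixture R _ _ _ _ (measurableTypeR R) R n (eb_prior alpha sigma2 x)
  lebesgue_measure `]0%R, 1%R[ (fun w => (beta1_pdf (alpha%:num * n%:R) w)%:E)
  (fun i theta => tnth theta i) (fun i => kspike_slab (tnth x i) sigma2) g)//.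
- apply: eq_integral => w; rewrite inE/= in_itv/= => w01; congr (_ * _)%E.
  by apply: eq_bigr => i _; rewrite integral_spike_slab.
- by move=> w; rewrite lee_fin mulr_ge0// powR_ge0.
- apply/measurable_EFinP; apply: measurable_funM => //.
- by move=> i B mB; exact: (@measurable_kernel _ _ R R R (kspike_slab (tnth x i) sigma2)).
- by move=> i; exact: measurable_tnth.
move=> B mB.
transitivity (eb_joint_prior alpha sigma2 x
    ([set theta | forall i, B i (tnth theta i)] `*` setT)).
  rewrite /eb_prior /pushforward; congr eb_joint_prior.
  by apply/seteqP; split => -[u v]//= [].
rewrite eb_joint_prior_box//; apply: eq_integral => w; rewrite inE/= in_itv/= => w01.
rewrite indicT mul1e; congr (_ * _)%E; apply: eq_bigr => i _.
by rewrite /kspike_slab/= /spike_slab unit_truncE.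
Qed.

(** * One-coordinate factors: the tempered normal density under the spike-and-slab law *)

Definition local_lik (R : realType) (kappa x y : R) : R :=
  normal_peak 1 `^ kappa * expR (- (kappa * (x - y) ^+ 2 / 2)).

Lemma likelihood_powR (R : realType) (n : nat) (kappa : R) (theta x : n.-tuple R) :
  likelihood theta x `^ kappa =
  \prod_(i < n) local_lik kappa (tnth x i) (tnth theta i).
Proof.
rewrite /likelihood.
transitivity (\prod_(i < n) (normal_pdf (tnth theta i) 1 (tnth x i) `^ kappa)).
  elim: (index_enum _) => [|i r IH]; first by rewrite !big_nil powR1.
  rewrite !big_cons powRM ?normal_pdf_ge0 ?IH//.
  by rewrite prodr_ge0// => j _; exact: normal_pdf_ge0.
apply: eq_bigr => i _; rewrite normal_pdfE ?oner_neq0// powRM ?normal_peak_ge0 ?normal_fun_ge0//.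
congr (_ * _); rewrite /local_lik /normal_fun -expRM; congr expR.
by field.
Qed.

(* The factor common to the bounds on the numerator and the denominator of the
   posterior. *)
Definition null_scale (R : realType) (kappa th x : R) : R :=
  normal_peak 1 `^ kappa * (if th == 0 then expR (- (kappa * x ^+ 2 / 2)) else 1).

(* A bound, in units of [null_scale], on the integral of
   [local_lik kappa x u * expR (t * (u - th) ^+ 2)] under the spike-and-slab law
   of [u]. *)
Definition slab_ratio (R : realType) (kappa sigma2 t th x w : R) : R :=
  if th == 0 then
    w + (1 - w) * (Num.sqrt (1 + (kappa - 4 * t) * sigma2))^-1 *
      expR ((kappa / 2 + 2 * t) * x ^+ 2)
  else expR (2 * t * (x - th) ^+ 2).

(* In units of [null_scale]: the contribution of the spike to the marginal
   likelihood if [th = 0], that of the slab otherwise. *)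
Definition spike_pattern (R : realType) (kappa sigma2 th w : R) : R :=
  if th == 0 then w else (1 - w) * (Num.sqrt (1 + kappa * sigma2))^-1.

Lemma null_scale_gt0 (R : realType) (kappa th x : R) : 0 < null_scale kappa th x.
Proof.
rewrite mulr_gt0 ?powR_gt0 ?normal_peak_gt0 ?oner_neq0//.
by case: ifP => // _; exact: expR_gt0.
Qed.

Lemma measurable_expR_sqr (R : realType) (a b : R) :
  measurable_fun [set: R] (fun y => expR (a * (y - b) ^+ 2)).
Proof.
apply: measurableT_comp => //; apply: measurable_funM => //.
by apply: measurable_funX => //; exact: measurable_funB.
Qed.

Lemma measurable_local_lik (R : realType) (kappa x : R) :
  measurable_fun [set: R] (local_lik kappa x).
Proof.
apply: measurable_funM => //.
under eq_fun => y.
  rewrite (_ : - _ = - kappa / 2 * (y - x) ^+ 2); last by field.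
  over.
exact: measurable_expR_sqr.
Qed.

(** Under the slab, [(y - th) ^+ 2 <= 2 * (x - th) ^+ 2 + 2 * (y - x) ^+ 2] moves the tilt onto the
    data and lowers the Gaussian coefficient from [kappa] to [kappa - 4 * t]. *)
Lemma spike_slab_factor_le (R : realType) (kappa sigma2 t th x w : R) :
  0 <= t -> 4 * t <= kappa -> 0 < sigma2 -> 0 < w < 1 ->
  (w%:E * (local_lik kappa x 0 * expR (t * (0 - th) ^+ 2))%:E +
   (1 - w)%:E * \int[normal_prob x (Num.sqrt sigma2)]_y
     (local_lik kappa x y * expR (t * (y - th) ^+ 2))%:E
   <= (null_scale kappa th x * slab_ratio kappa sigma2 t th x w)%:E)%E.
Proof.
move=> t0 tk s0 /andP[w0 w1].
pose g y := local_lik kappa x y * expR (t * (y - th) ^+ 2).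
set p := normal_peak 1 `^ kappa.
have p0 : 0 <= p by exact: powR_ge0.
set c := (Num.sqrt (1 + (kappa - 4 * t) * sigma2))^-1.
have ks : 0 <= (kappa - 4 * t) * sigma2 by rewrite mulr_ge0 ?subr_ge0 ?(ltW s0).
have c1 : c <= 1.
  rewrite invf_le1 ?sqrtr_gt0; last by rewrite ltr_pwDl.
  by rewrite -[leLHS]sqrtr1 ler_sqrt ?lerDl// addr_ge0.
have int_le : (\int[normal_prob x (Num.sqrt sigma2)]_y (g y)%:E <=
    (p * expR (2 * t * (x - th) ^+ 2) * c)%:E)%E.
  have sE : Num.sqrt sigma2 ^+ 2 = sigma2 by rewrite sqr_sqrtr// ltW.
  have := @integral_normal_prob_gauss _ x (Num.sqrt sigma2) (kappa - 4 * t).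
  rewrite sE sqrtr_eq0 -ltNge -/c => /(_ s0) G.
  rewrite EFinM -{}G; last by rewrite ltr_pwDl.
  rewrite -ge0_integralZl//; last 2 first.
  - apply/measurable_EFinP.
    under eq_fun => y.
      rewrite (_ : - _ = - (kappa - 4 * t) / 2 * (y - x) ^+ 2); last by field.
      over.
    exact: measurable_expR_sqr.
  - by rewrite lee_fin mulr_ge0 ?expR_ge0.
  apply: ge0_le_integral => //.
  - by move=> y _; rewrite lee_fin !mulr_ge0 ?expR_ge0.
  - by apply/measurable_EFinP; apply: measurable_funM;
      [exact: measurable_local_lik|exact: measurable_expR_sqr].
  - apply/measurable_EFinP; apply: measurable_funM => //.
    under eq_fun => y.
      rewrite (_ : - _ = - (kappa - 4 * t) / 2 * (y - x) ^+ 2); last by field.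
      over.
    exact: measurable_expR_sqr.
  move=> y _; rewrite -EFinM lee_fin /g /local_lik -!mulrA ler_wpM2l// -!expRD ler_expR.
  rewrite -subr_ge0.
  rewrite [leRHS](_ : _ = t * (x - th - (y - x)) ^+ 2); last by field.
  by rewrite mulr_ge0 ?sqr_ge0.
apply: (@le_trans _ _ (w%:E * (g 0%R)%:E +
    (1 - w)%:E * (p * expR (2 * t * (x - th) ^+ 2) * c)%:E)%E).
  by apply: leeD => //; apply: lee_wpmul2l => //; rewrite lee_fin subr_ge0 ltW.
rewrite -!EFinM -EFinD lee_fin /null_scale /slab_ratio /g /local_lik -/p -/c.
case: ifPn => [/eqP ->|th0].
  rewrite !subr0 expr0n/= mulr0 expR0 mulr1.
  rewrite (_ : expR (2 * t * x ^+ 2) =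
    expR (- (kappa * x ^+ 2 / 2)) * expR ((kappa / 2 + 2 * t) * x ^+ 2)); last first.
    by rewrite -expRD; congr expR; field.
  by rewrite le_eqVlt; apply/orP; left; apply/eqP; ring.
rewrite subr0 sub0r sqrrN mulr1.
set q := expR (2 * _ * _).
(* The spike at a support coordinate: completing the square leaves [(kappa - 4 * t) * x ^+ 2 / 2],
   nonnegative by the choice of [t]. Spike and slab are then both at most [p * q], and their weights
   add up to [1]. *)
have h : expR (- (kappa * x ^+ 2 / 2)) * expR (t * th ^+ 2) <= q.
  rewrite -expRD ler_expR -subr_ge0.
  rewrite [leRHS](_ : _ =
    (kappa - 4 * t) * x ^+ 2 / 2 + t * (2 * x - th) ^+ 2); last by field.
  have k4 : 0 <= kappa - 4 * t by rewrite subr_ge0.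
  apply: addr_ge0; last exact: mulr_ge0 (sqr_ge0 _).
  by apply: divr_ge0 => //; exact: mulr_ge0 (sqr_ge0 _).
have q0 : 0 <= q by exact: expR_ge0.
rewrite [leRHS](_ : _ = w * (p * q) + (1 - w) * (p * q)); last by ring.
apply: lerD; first by rewrite ler_pM2l// -[leLHS]mulrA ler_wpM2l.
apply: ler_wpM2l; first by rewrite subr_ge0 ltW.
by apply: ler_piMr => //; exact: mulr_ge0.
Qed.

(** One of the two components is dropped. The slab is centred at the observation [x], so its
    Gaussian integral is explicit and free of [x]. *)
Lemma spike_slab_factor_ge (R : realType) (kappa sigma2 th x w : R) :
  0 <= kappa -> 0 < sigma2 -> 0 < w < 1 ->
  ((null_scale kappa th x * spike_pattern kappa sigma2 th w)%:E <=
   w%:E * (local_lik kappa x 0)%:E +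
   (1 - w)%:E * \int[normal_prob x (Num.sqrt sigma2)]_y (local_lik kappa x y)%:E)%E.
Proof.
move=> k0 s0 /andP[w0 w1].
pose g y := local_lik kappa x y.
set p := normal_peak 1 `^ kappa.
have p0 : 0 <= p by exact: powR_ge0.
have g0 y : 0 <= g y by rewrite mulr_ge0 ?expR_ge0.
rewrite /null_scale /spike_pattern -/p.
case: ifPn => [/eqP _|th0].
  rewrite (_ : _ * _ * w = w * g 0); last by rewrite /g /local_lik subr0 -/p; ring.
  rewrite EFinM leeDl// mule_ge0 ?lee_fin ?subr_ge0 ?(ltW w1)//.
  by apply: integral_ge0 => y _; rewrite lee_fin.
apply: (@le_trans _ _ ((1 - w)%:E *
    \int[normal_prob x (Num.sqrt sigma2)]_y (g y)%:E)%E); last first.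
  by rewrite leeDr// mule_ge0 ?lee_fin// ltW.
rewrite mulr1 mulrCA EFinM lee_wpmul2l ?lee_fin ?subr_ge0 ?(ltW w1)//.
have sE : Num.sqrt sigma2 ^+ 2 = sigma2 by rewrite sqr_sqrtr// ltW.
have := @integral_normal_prob_gauss _ x (Num.sqrt sigma2) kappa.
rewrite sE sqrtr_eq0 -ltNge => /(_ s0) G.
rewrite EFinM -{}G; last by rewrite ltr_pwDl// mulr_ge0// ltW.
rewrite -ge0_integralZl//; last first.
  apply/measurable_EFinP.
  under eq_fun => y.
    rewrite (_ : - _ = - kappa / 2 * (y - x) ^+ 2); last by field.
    over.
  exact: measurable_expR_sqr.
rewrite le_eqVlt; apply/orP; left; apply/eqP; apply: eq_integral => y _.
rewrite -EFinM /local_lik -/p; congr (_ * expR _)%:E.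
by ring.
Qed.

Lemma measurable_slab_ratio (R : realType) (kappa sigma2 t th x : R) :
  measurable_fun [set: R] (slab_ratio kappa sigma2 t th x).
Proof.
rewrite /slab_ratio; case: (th == 0) => //.
apply: measurable_funD => //; apply: measurable_funM => //.
by apply: measurable_funM => //; exact: measurable_funB.
Qed.

Lemma measurable_spike_pattern (R : realType) (kappa sigma2 th : R) :
  measurable_fun [set: R] (spike_pattern kappa sigma2 th).
Proof.
rewrite /spike_pattern; case: (th == 0) => //.
by apply: measurable_funM => //; exact: measurable_funB.
Qed.

Lemma slab_ratio_ge0 (R : realType) (kappa sigma2 t th x w : R) :
  0 <= w <= 1 -> 0 <= slab_ratio kappa sigma2 t th x w.
Proof.
move=> /andP[w0 w1]; rewrite /slab_ratio; case: ifP => _; last exact: expR_ge0.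
by rewrite addr_ge0// !mulr_ge0 ?expR_ge0 ?invr_ge0// subr_ge0.
Qed.

Lemma spike_pattern_ge0 (R : realType) (kappa sigma2 th w : R) :
  0 <= w <= 1 -> 0 <= spike_pattern kappa sigma2 th w.
Proof.
move=> /andP[w0 w1]; rewrite /spike_pattern; case: ifP => // _.
by rewrite mulr_ge0 ?invr_ge0// subr_ge0.
Qed.

Lemma beta1_pdf_ge0 (R : realType) (a w : R) : 0 <= a -> 0 <= beta1_pdf a w.
Proof. by move=> a0; rewrite mulr_ge0// powR_ge0. Qed.

Lemma measurable_beta1_pdf (R : realType) (a : R) : measurable_fun [set: R] (beta1_pdf a).
Proof. by apply: measurable_funM => //. Qed.

(** * Bounds on the numerator and the denominator of the posterior *)

Lemma l2dist_sqr (R : realType) (n : nat) (u v : n.-tuple R) :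
  l2dist u v ^+ 2 = \sum_(i < n) (tnth u i - tnth v i) ^+ 2.
Proof. by rewrite sqr_sqrtr// sumr_ge0// => i _; exact: sqr_ge0. Qed.

Lemma measurable_l2dist_gt (R : realType) (n : nat) (v : n.-tuple R) (r : R) :
  measurable [set u : n.-tuple R | r < l2dist u v ^+ 2].
Proof.
have mf : measurable_fun [set: n.-tuple R] (fun u : n.-tuple R => l2dist u v ^+ 2).
  under eq_fun do rewrite l2dist_sqr.
  apply: measurable_sum => i; apply: measurable_funX; apply: measurable_funB => //.
  exact: measurable_tnth.
rewrite (_ : [set _ | _] = (fun u : n.-tuple R => l2dist u v ^+ 2) @^-1` `]r, +oo[).
  by rewrite -[X in measurable X]setTI; apply: mf => //; exact: measurable_itv.
by apply/seteqP; split => u /=; rewrite in_itv/= andbT.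
Qed.

(** On the bad set [expR (t * (l2dist u ths ^+ 2 - r))] is at least [1]. Inserting it and enlarging
    the domain leaves a product over coordinates, to which [integral_eb_prior] and
    [spike_slab_factor_le] apply. *)
Lemma eb_numerator_le (R : realType) (n : nat) (alpha : {posnum R})
    (kappa sigma2 t r : R) (x ths : n.-tuple R) :
  0 <= t -> 4 * t <= kappa -> 0 < sigma2 ->
  (\int[eb_prior alpha sigma2 x]_(theta in [set u | (r < l2dist u ths ^+ 2)%R])
     (likelihood theta x `^ kappa)%:E <=
   (expR (- (t * r)) * \prod_(i < n) null_scale kappa (tnth ths i) (tnth x i))%:E *
   \int[lebesgue_measure]_(w in `]0%R, 1%R[)
     (beta1_pdf (alpha%:num * n%:R) w *
      \prod_(i < n) slab_ratio kappa sigma2 t (tnth ths i) (tnth x i) w)%:E)%E.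
Proof.
move=> t0 tk s0.
pose g i y : R := local_lik kappa (tnth x i) y * expR (t * (y - tnth ths i) ^+ 2).
have g0 i y : 0 <= g i y by rewrite !mulr_ge0 ?expR_ge0 ?powR_ge0.
have mg i : measurable_fun [set: R] (g i).
  by apply: measurable_funM; [exact: measurable_local_lik|exact: measurable_expR_sqr].
have mgt i : measurable_fun [set: n.-tuple R] (fun u : n.-tuple R => g i (tnth u i)).
  by apply: measurableT_comp => //; exact: measurable_tnth.
have mA := measurable_l2dist_gt ths r.
have mL : measurable_fun [set: n.-tuple R]
    (fun theta : n.-tuple R => (likelihood theta x `^ kappa)%:E).
  apply/measurable_EFinP; under eq_fun do rewrite likelihood_powR.
  apply: measurable_prod => i _.
  apply: (measurableT_comp (measurable_local_lik kappa (tnth x i))).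
  exact: measurable_tnth.
apply: (@le_trans _ _ (\int[eb_prior alpha sigma2 x]_theta
    ((expR (- (t * r)))%:E * \prod_(i < n) (g i (tnth theta i))%:E))%E).
  apply: (@le_trans _ _ (\int[eb_prior alpha sigma2 x]_(theta in
      [set u | (r < l2dist u ths ^+ 2)%R])
    ((expR (- (t * r)))%:E * \prod_(i < n) (g i (tnth theta i))%:E))%E).
    apply: ge0_le_integral => //.
    - by move=> theta _; rewrite lee_fin powR_ge0.
    - exact: measurable_funTS.
    - apply: measurable_funTS; apply: emeasurable_funM => //.
      by apply: emeasurable_prod => i; apply/measurable_EFinP.
    move=> theta /= rt; rewrite prod_EFin -EFinM lee_fin likelihood_powR.
    rewrite [in leRHS]/g [in leRHS]big_split/= mulrCA ler_peMr ?prodr_ge0//.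
      by move=> i _; rewrite mulr_ge0 ?expR_ge0 ?powR_ge0.
    rewrite -expR_sum -expRD -[leLHS]expR0 ler_expR -mulr_sumr -l2dist_sqr.
    by rewrite addrC subr_ge0 ler_wpM2l// ltW.
  apply: ge0_subset_integral => //.
    apply: emeasurable_funM => //.
    by apply: emeasurable_prod => i; apply/measurable_EFinP.
  move=> theta _; apply: mule_ge0; first by rewrite lee_fin expR_ge0.
  by apply: prode_ge0 => i _; rewrite lee_fin.
rewrite ge0_integralZl//; last 2 first.
- by apply: emeasurable_prod => i; apply/measurable_EFinP.
- by move=> theta _; apply: prode_ge0 => i _; rewrite lee_fin.
rewrite EFinM -muleA lee_wpmul2l ?lee_fin ?expR_ge0//.
rewrite (@integral_eb_prior R n alpha sigma2 x (fun i y => (g i y)%:E))//; last first.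
  by move=> i; apply/measurable_EFinP.
pose S w := \prod_(i < n) slab_ratio kappa sigma2 t (tnth ths i) (tnth x i) w.
have mS : measurable_fun [set: R] S.
  by apply: measurable_prod => i _; exact: measurable_slab_ratio.
have mb := measurable_beta1_pdf (alpha%:num * n%:R).
have b0 w : 0 <= beta1_pdf (alpha%:num * n%:R) w by exact: beta1_pdf_ge0.
have N0 : 0 <= \prod_(i < n) null_scale kappa (tnth ths i) (tnth x i).
  by rewrite prodr_ge0// => i _; rewrite ltW// null_scale_gt0.
rewrite -ge0_integralZl//; last 2 first.
- by apply: measurable_funTS; apply/measurable_EFinP; apply: measurable_funM.
- move=> w; rewrite /= in_itv/= => /andP[/ltW w0 /ltW w1].
  by rewrite lee_fin mulr_ge0// prodr_ge0// => i _; rewrite slab_ratio_ge0 ?w0.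
apply: ge0_le_integral => //.
- move=> w; rewrite /= in_itv/= => /andP[/ltW w0 /ltW w1].
  rewrite mule_ge0 ?lee_fin// prode_ge0// => i _.
  rewrite adde_ge0// mule_ge0 ?lee_fin ?subr_ge0//.
  by apply: integral_ge0 => y _; rewrite lee_fin.
- apply: measurable_funTS; apply: emeasurable_funM; first exact/measurable_EFinP.
  apply: emeasurable_prod => i; apply: emeasurable_funD.
    by apply: emeasurable_funM => //; exact/measurable_EFinP.
  apply: emeasurable_funM => //; apply/measurable_EFinP; exact: measurable_funB.
- apply: measurable_funTS; apply: emeasurable_funM => //.
  by apply/measurable_EFinP; apply: measurable_funM.
move=> w; rewrite /= in_itv/= => w01; have /andP[/ltW w0 /ltW w1] := w01.
rewrite [X in (_ <= _ * X)%E]EFinM [leRHS]muleCA lee_wpmul2l ?lee_fin//.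
rewrite -EFinM /S -big_split/= -prod_EFin; apply: lee_prod => i _.
rewrite spike_slab_factor_le// andbT adde_ge0// mule_ge0 ?lee_fin ?subr_ge0//.
by apply: integral_ge0 => y _; rewrite lee_fin.
Qed.

Lemma eb_denominator_ge (R : realType) (n : nat) (alpha : {posnum R})
    (kappa sigma2 : R) (x ths : n.-tuple R) :
  0 <= kappa -> 0 < sigma2 ->
  ((\prod_(i < n) null_scale kappa (tnth ths i) (tnth x i))%:E *
   \int[lebesgue_measure]_(w in `]0%R, 1%R[)
     (beta1_pdf (alpha%:num * n%:R) w *
      \prod_(i < n) spike_pattern kappa sigma2 (tnth ths i) w)%:E <=
   \int[eb_prior alpha sigma2 x]_theta (likelihood theta x `^ kappa)%:E)%E.
Proof.
move=> k0 s0.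
have l0 i y : 0 <= local_lik kappa (tnth x i) y.
  by rewrite mulr_ge0 ?expR_ge0 ?powR_ge0.
have ml i : measurable_fun [set: R] (local_lik kappa (tnth x i)).
  exact: measurable_local_lik.
have -> : (\int[eb_prior alpha sigma2 x]_theta (likelihood theta x `^ kappa)%:E =
    \int[eb_prior alpha sigma2 x]_theta
      \prod_(i < n) (local_lik kappa (tnth x i) (tnth theta i))%:E)%E.
  by apply: eq_integral => theta _; rewrite likelihood_powR prod_EFin.
rewrite (@integral_eb_prior R n alpha sigma2 x
  (fun i y => (local_lik kappa (tnth x i) y)%:E))//; last first.
  by move=> i; apply/measurable_EFinP.
pose S w := \prod_(i < n) spike_pattern kappa sigma2 (tnth ths i) w.
have mS : measurable_fun [set: R] S.
  by apply: measurable_prod => i _; exact: measurable_spike_pattern.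
have mb := measurable_beta1_pdf (alpha%:num * n%:R).
have b0 w : 0 <= beta1_pdf (alpha%:num * n%:R) w by exact: beta1_pdf_ge0.
have N0 : 0 <= \prod_(i < n) null_scale kappa (tnth ths i) (tnth x i).
  by rewrite prodr_ge0// => i _; rewrite ltW// null_scale_gt0.
have S0 w : w \in `]0%R, 1%R[ -> 0 <= S w.
  rewrite /= in_itv/= => /andP[/ltW w0 /ltW w1].
  by apply: prodr_ge0 => i _; apply: spike_pattern_ge0; rewrite w0.
rewrite -ge0_integralZl//; last 2 first.
- by apply: measurable_funTS; apply/measurable_EFinP; apply: measurable_funM.
- by move=> w /S0 Sw; rewrite lee_fin mulr_ge0.
apply: ge0_le_integral => //.
- by move=> w /S0 Sw; apply: mule_ge0; rewrite lee_fin// mulr_ge0.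
- apply: measurable_funTS; apply: emeasurable_funM => //.
  by apply/measurable_EFinP; apply: measurable_funM.
- apply: measurable_funTS; apply: emeasurable_funM; first exact/measurable_EFinP.
  apply: emeasurable_prod => i; apply: emeasurable_funD.
    by apply: emeasurable_funM => //; exact/measurable_EFinP.
  apply: emeasurable_funM => //; apply/measurable_EFinP; exact: measurable_funB.
move=> w; rewrite /= in_itv/= => w01; have /andP[/ltW w0 /ltW w1] := w01.
rewrite [X in (_ * X <= _)%E]EFinM [leLHS]muleCA lee_wpmul2l ?lee_fin//.
rewrite -EFinM /S -big_split/= -prod_EFin; apply: lee_prod => i _.
rewrite spike_slab_factor_ge// andbT lee_fin mulr_ge0 ?spike_pattern_ge0 ?w0//.
by rewrite ltW// null_scale_gt0.
Qed.

Lemma prod_sparse (R : realType) (n s : nat) (ths : n.-tuple R) (a b : R) :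
  sparse s ths ->
  \prod_(i < n) (if tnth ths i == 0 then a else b) = a ^+ (n - s) * b ^+ s.
Proof.
move=> hs; rewrite big_if/=.
have cs : #|[pred i | tnth ths i != 0]| = s.
  by rewrite -hs; apply: eq_card => i; rewrite inE.
have cn : #|[pred i | tnth ths i == 0]| = (n - s)%N.
  rewrite -cs -[X in (X - _)%N](card_ord n) -(cardC [pred i | tnth ths i != 0]) addKn.
  by apply: eq_card => i; rewrite !inE negbK.
by congr (_ * _); [rewrite -cn -prodr_const|rewrite -cs -prodr_const].
Qed.

Lemma sparse_le (R : realType) (n s : nat) (ths : n.-tuple R) :
  sparse s ths -> (s <= n)%N.
Proof. by move=> <-; rewrite -[leqRHS](card_ord n) max_card. Qed.

(** From [1 + 4 * d <= expR (4 * d)] and [1 <= (1 + 4 * d) * (1 - 2 * d)]. It turns powers of a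
    weight near [1] into exponentials. *)
Lemma expR_N4_le (R : realType) (d : R) :
  0 < d -> d <= 1 / 4 -> expR (- (4 * d)) <= 1 - 2 * d.
Proof.
move=> d0 d4; rewrite expRN.
apply: (@le_trans _ _ (1 + 4 * d)^-1).
  by rewrite lef_pV2 ?posrE ?expR_gt0 ?expR_ge1Dx//; lra.
rewrite -[leLHS]mul1r ler_pdivrMr; last lra.
have := mulr_ge0 (ltW d0) (_ : 0 <= 1 - 4 * d); nra.
Qed.

Lemma spike_pattern_integral_ge (R : realType) (n s : nat) (alpha : {posnum R})
    (kappa sigma2 : R) (ths : n.-tuple R) :
  sparse s ths -> (0 < s)%N -> (4 * s <= n)%N ->
  ((alpha%:num * s%:R * expR (- (4 * (alpha%:num + 1) * s%:R)) *
    (s%:R / n%:R * (Num.sqrt (1 + kappa * sigma2))^-1) ^+ s)%:E <=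
   \int[lebesgue_measure]_(w in `]0%R, 1%R[)
     (beta1_pdf (alpha%:num * n%:R) w *
      \prod_(i < n) spike_pattern kappa sigma2 (tnth ths i) w)%:E)%E.
Proof.
(* Only [1 - 2 s / n <= w <= 1 - s / n] is used. *)
move=> hs s0 sn.
set c := (Num.sqrt _)^-1.
have c0 : 0 <= c by rewrite invr_ge0.
have n0 : (0 < n)%N by rewrite (leq_trans _ sn)// muln_gt0.
have nR0 : 0 < n%:R :> R by rewrite ltr0n.
have sR0 : 0 < s%:R :> R by rewrite ltr0n.
set d : R := s%:R / n%:R.
have d0 : 0 < d by exact: divr_gt0.
have d4 : d <= 1 / 4.
  rewrite ler_pdivrMr// mulrAC ler_pdivlMr// mul1r mulrC.
  by rewrite -natrM ler_nat.
have dn : d * n%:R = s%:R by rewrite divfK// gt_eqF.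
have a0 := @gt0 _ _ alpha.
pose f w := (beta1_pdf (alpha%:num * n%:R) w *
  \prod_(i < n) spike_pattern kappa sigma2 (tnth ths i) w)%:E.
have f0 w : w \in `]0%R, 1%R[ -> (0 <= f w)%E.
  rewrite /= in_itv/= => /andP[/ltW w0 /ltW w1].
  rewrite /f lee_fin mulr_ge0 ?beta1_pdf_ge0//.
  by apply: prodr_ge0 => i _; apply: spike_pattern_ge0; rewrite w0.
have sub : `[1 - 2 * d, 1 - d] `<=` `]0%R, 1%R[.
  move=> w /=; rewrite !in_itv/= => /andP[w1 w2]; apply/andP; split; lra.
have mf : measurable_fun [set: R] f.
  apply/measurable_EFinP; apply: measurable_funM; first exact: measurable_beta1_pdf.
  by apply: measurable_prod => i _; exact: measurable_spike_pattern.
apply: (@le_trans _ _ (\int[lebesgue_measure]_(w in `[(1 - 2 * d)%R, (1 - d)%R]) f w)%E);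
  last first.
  apply: ge0_subset_integral => //; first exact: measurable_funTS.
pose e := expR (- (4 * d)).
have e0 : 0 < e by exact: expR_gt0.
(* A lower bound for the integrand on the window, where [e <= w] and [d <= 1 - w]. Multiplying by
   the window length [d] turns [alpha * n] into [alpha * s]. *)
pose q := (alpha%:num * n%:R) * e `^ (alpha%:num * n%:R) * (e ^+ n * (d * c) ^+ s).
have q0 : 0 <= q.
  by rewrite !mulr_ge0 ?exprn_ge0 ?mulr_ge0 ?powR_ge0// ltW.
apply: (@le_trans _ _ (\int[lebesgue_measure]_(w in `[(1 - 2 * d)%R, (1 - d)%R]) q%:E)%E).
  rewrite integral_cst//= lebesgue_measure_itv/= lte_fin ifT; last lra.
  rewrite -EFinD -EFinM lee_fin le_eqVlt; apply/orP; left; apply/eqP.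
  rewrite (_ : 1 - d - (1 - 2 * d) = d); last by ring.
  rewrite /q /e -expRM -expRM_natl.
  rewrite (_ : alpha%:num * s%:R = alpha%:num * n%:R * d);
    last by rewrite -mulrA (mulrC n%:R) dn.
  rewrite (_ : - (4 * (alpha%:num + 1) * s%:R) =
    - (4 * d) * (alpha%:num * n%:R) + n%:R * (- (4 * d))); last by rewrite -dn; ring.
  by rewrite expRD; ring.
apply: ge0_le_integral => //; first exact: measurable_funTS.
move=> w /=; rewrite in_itv/= => /andP[w1 w2].
have ew : e <= w by apply: le_trans w1; exact: expR_N4_le.
have w0 : 0 < w by lra.
have wl1 : w <= 1 by lra.
rewrite lee_fin /q ler_pM//.
- by rewrite !mulr_ge0 ?powR_ge0// ltW.
- by rewrite mulr_ge0 ?exprn_ge0 ?mulr_ge0// ltW.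
- rewrite /beta1_pdf ler_wpM2l ?mulr_ge0// ?(ltW a0)//.
  (* Since [w <= 1], raising the exponent from [alpha * n - 1] to [alpha * n] only lowers the power,
     and the sign of [alpha * n - 1] does not matter. *)
  apply: (@le_trans _ _ (w `^ (alpha%:num * n%:R))).
    by apply: ge0_ler_powR; rewrite ?nnegrE ?mulr_ge0// ltW.
  by apply: ger_powR; [rewrite w0|lra].
rewrite /spike_pattern (prod_sparse _ _ hs) -/c.
apply: ler_pM; rewrite ?exprn_ge0 ?mulr_ge0// ?(ltW d0) ?(ltW e0)//.
  apply: (@le_trans _ _ (e ^+ (n - s))).
    apply: ler_wiXn2l; rewrite ?(ltW e0) ?leq_subr//; lra.
  by rewrite lerXn2r ?nnegrE ?(ltW e0) ?(ltW w0).
rewrite lerXn2r ?nnegrE ?mulr_ge0// ?(ltW d0)//; first lra.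
by rewrite ler_wpM2r//; lra.
Qed.

(** * Expectation of the numerator bound under the true law *)

(** Independence is the condition on boxes of [integral_prod_mixture] when the mixing space is a
    single point. *)
Lemma expectation_prod_normal (R : realType) (d : measure_display)
    (Omega : measurableType d) (P : probability Omega R) (n : nat)
    (X : 'I_n -> {RV P >-> R}) (ths : n.-tuple R) (g : 'I_n -> R -> \bar R) :
  mutually_independent X ->
  (forall i (A : set R), measurable A ->
     distribution P (X i) A = normal_prob (tnth ths i) 1 A) ->
  (forall i, measurable_fun [set: R] (g i)) -> (forall i y, (0 <= g i y)%E) ->
  (\int[P]_omega \prod_(i < n) g i (X i omega) =
   \prod_(i < n) \int[normal_prob (tnth ths i) 1]_y g i y)%E.
Proof.
move=> indep normal mg g0.
rewrite (@integral_prod_mixture R _ _ _ Omega unit R n P \d_tt setT (fun=> 1%E)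
  (fun i => X i) (fun i _ => distribution P (X i)) g)//.
- rewrite integral_dirac// diracT !mul1e; apply: eq_bigr => i _.
  by apply/esym/eq_measure_integral_display => // A mA; exact/esym/normal.
move=> B mB; rewrite integral_dirac// diracT !mul1e.
have := indep [set: 'I_n]%SET B mB; set U := \bigcap_(i in _) _.
rewrite (_ : U = [set t | forall i, B i (X i t)]).
  by move=> E; apply: etrans E _; apply: eq_bigl => i; rewrite inE.
by apply/seteqP; split => t /= h i; [have := h i; rewrite /= inE; exact|move=> _; exact: h].
Qed.

(** Both cases are chi-square moment generating functions. On the support the value is
    [(1 - 4 * t)^(-1/2)], at most [2] as [4 * t <= 3 / 4]. At a null coordinate the factor of
    [1 - w] is the inverse root of the product assumed to be at least [1], so a convex combination
    of numbers at most [1] remains. *)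
Lemma slab_ratio_expectation_le (R : realType) (kappa sigma2 t th w : R) :
  0 <= t -> 4 * t <= 3 / 4 -> 4 * t < 1 - kappa -> 4 * t <= kappa -> 0 < sigma2 ->
  1 <= (1 + (kappa - 4 * t) * sigma2) * (1 - kappa - 4 * t) ->
  0 <= w <= 1 ->
  (\int[normal_prob th 1]_y (slab_ratio kappa sigma2 t th y w)%:E <=
   (if th == 0 then 1 else 2)%R%:E)%E.
Proof.
move=> t0 t34 t1k tk s0 key /andP[w0 w1].
rewrite /slab_ratio; case: ifPn => [/eqP ->|th0]; last first.
  rewrite [leLHS](_ : _ = (\int[normal_prob th 1]_y
      (expR (- (- (4 * t) * (y - th) ^+ 2 / 2)))%:E)%E); last first.
    by apply: eq_integral => y _; congr (expR _)%:E; field.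
  rewrite integral_normal_prob_gauss ?oner_neq0// expr1n mulr1; last lra.
  rewrite lee_fin -[leRHS]invrK lef_pV2 ?posrE ?sqrtr_gt0; [|lra|lra].
  rewrite -(@ger0_norm _ (2^-1 : R)) ?invr_ge0// -sqrtr_sqr ler_sqrt; last lra.
  by rewrite expr2; lra.
set c := (Num.sqrt _)^-1.
have c0 : 0 <= c by rewrite invr_ge0.
have mq : measurable_fun [set: R]
    (fun y : R => expR (- (- (kappa + 4 * t) * (y - 0) ^+ 2 / 2))).
  under eq_fun => y.
    rewrite (_ : - (_ / 2) = (kappa + 4 * t) / 2 * (y - 0) ^+ 2); last by field.
    over.
  exact: measurable_expR_sqr.
rewrite [leLHS](_ : _ = (\int[normal_prob 0 1]_y (w%:E + ((1 - w) * c)%:E *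
    (expR (- (- (kappa + 4 * t) * (y - 0) ^+ 2 / 2)))%:E))%E); last first.
  apply: eq_integral => y _; rewrite -EFinM -EFinD; congr (_ + _ * expR _)%:E.
  by field.
have wc0 : 0 <= (1 - w) * c by rewrite mulr_ge0// subr_ge0.
rewrite ge0_integralD//; last 2 first.
- by move=> y _; rewrite mule_ge0 ?lee_fin ?expR_ge0.
- by apply: emeasurable_funM => //; exact/measurable_EFinP.
rewrite integral_cst//= ge0_integralZl//; last exact/measurable_EFinP.
rewrite integral_normal_prob_gauss ?oner_neq0// expr1n mulr1; last lra.
rewrite [X in (_ * X)%E]probability_setT mule1 -EFinM -EFinD lee_fin.
have A0 : 0 < 1 + (kappa - 4 * t) * sigma2.
  by rewrite ltr_pwDl// mulr_ge0 ?(ltW s0)// subr_ge0.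
have cq : c * (Num.sqrt (1 + - (kappa + 4 * t)))^-1 <= 1.
  rewrite -invfM -sqrtrM ?(ltW A0)// invf_le1.
    by rewrite -[leLHS]sqrtr1 ler_sqrt opprD addrA// (le_trans _ key).
  by rewrite sqrtr_gt0 mulr_gt0//; lra.
rewrite -[leRHS](subrKC w) lerD2l -mulrA -[leRHS]mulr1.
by rewrite ler_wpM2l// subr_ge0.
Qed.

(** Tonelli exchanges the weight and the data. For fixed [w] only the support coordinates cost a
    factor [2], and the Beta density is at most [alpha * n]. *)
Lemma slab_ratio_moment (R : realType) (d : measure_display)
    (Omega : measurableType d) (P : probability Omega R) (n s : nat)
    (alpha : {posnum R}) (kappa sigma2 t : R)
    (X : 'I_n -> {RV P >-> R}) (ths : n.-tuple R) :
  mutually_independent X ->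
  (forall i (A : set R), measurable A ->
     distribution P (X i) A = normal_prob (tnth ths i) 1 A) ->
  sparse s ths ->
  0 <= t -> 4 * t <= 3 / 4 -> 4 * t < 1 - kappa -> 4 * t <= kappa -> 0 < sigma2 ->
  1 <= (1 + (kappa - 4 * t) * sigma2) * (1 - kappa - 4 * t) ->
  1 <= alpha%:num * n%:R ->
  let Z omega := (\int[lebesgue_measure]_(w in `]0%R, 1%R[)
    (beta1_pdf (alpha%:num * n%:R) w *
     \prod_(i < n) slab_ratio kappa sigma2 t (tnth ths i) (X i omega) w)%:E)%E in
  measurable_fun [set: Omega] Z /\
  (\int[P]_omega Z omega <= (alpha%:num * n%:R * 2 ^+ s)%:E)%E.
Proof.
move=> indep normal hs t0 t34 t1k tk s0 key an1 Z.
pose S omega w := \prod_(i < n) slab_ratio kappa sigma2 t (tnth ths i) (X i omega) w.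
pose F (z : Omega * R) : \bar R :=
  ((\1_`]0%R, 1%R[ z.2)%:E * (beta1_pdf (alpha%:num * n%:R) z.2 * S z.1 z.2)%:E)%E.
have itvP (w : R) : w \in `]0%R, 1%R[ -> 0 <= w <= 1.
  by rewrite /= in_itv/= => /andP[/ltW -> /ltW ->].
have F0 z : (0 <= F z)%E.
  rewrite /F indicE; case: (boolP (z.2 \in _)) => [/set_mem/= w01|_]; last by rewrite mul0e.
  rewrite mul1e lee_fin mulr_ge0 ?beta1_pdf_ge0//.
  by apply: prodr_ge0 => i _; apply: slab_ratio_ge0; exact: itvP.
have mF : measurable_fun [set: Omega * measurableTypeR R] F.
  apply: emeasurable_funM.
    apply/measurable_EFinP; apply: (measurableT_comp (measurable_indic _)) => //.
  apply/measurable_EFinP; apply: measurable_funM.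
    exact: (measurableT_comp (measurable_beta1_pdf _) measurable_snd).
  apply: measurable_prod => i _.
  have mX : measurable_fun [set: Omega * measurableTypeR R]
      (fun z : Omega * measurableTypeR R => X i z.1).
    exact: (measurableT_comp _ measurable_fst).
  have m2 : measurable_fun [set: Omega * measurableTypeR R]
      (fun z : Omega * measurableTypeR R => z.2 : R) by exact: measurable_snd.
  rewrite /slab_ratio; case: (tnth ths i == 0).
    apply: measurable_funD => //; apply: measurable_funM.
      by apply: measurable_funM => //; exact: measurable_funB.
    apply: measurableT_comp => //; apply: measurable_funM => //.
    exact: measurable_funX.
  apply: measurableT_comp => //; apply: measurable_funM => //.
  by apply: measurable_funX; exact: measurable_funB.
have ZE omega : Z omega = (\int[lebesgue_measure]_w F (omega, w))%E.
  rewrite /Z integral_mkcond; apply: eq_integral => w _.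
  by rewrite patchE /F/= indicE; case: ifP; rewrite ?mul1e ?mul0e.
have ZE' : Z = fun omega => (\int[lebesgue_measure]_w F (omega, w))%E by exact/funext.
split.
  rewrite ZE'; exact: measurable_fun_fubini_tonelli_F.
rewrite ZE' (@fubini_tonelli _ _ Omega (measurableTypeR R) R P lebesgue_measure F)//.
apply: (@le_trans _ _ (\int[lebesgue_measure]_w
    ((\1_`]0%R, 1%R[ w)%:E * (alpha%:num * n%:R * 2 ^+ s)%:E))%E); last first.
  rewrite ge0_integralZr//; last first.
    by apply/measurable_EFinP; exact: measurable_indic.
  rewrite integral_indic// setIT/= lebesgue_measure_itv/= lte01.
  by rewrite oppr0 adde0 mul1e.
have an0 : 0 <= alpha%:num * n%:R by rewrite (le_trans ler01).
apply: ge0_le_integral => //.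
- by move=> w _; apply: integral_ge0.
- exact: measurable_fun_fubini_tonelli_G.
- apply: emeasurable_funM => //; apply/measurable_EFinP; exact: measurable_indic.
move=> w _; rewrite /F/= indicE; case: (boolP (w \in _)) => [/set_mem/= w01|_]; last first.
  by rewrite mul0e integral0_eq// => omega _; rewrite mul0e.
have {}w01 : 0 <= (w : R) <= 1 by apply: (itvP w).
rewrite mul1e (_ : (\int[P]_omega _ = \int[P]_omega
  ((beta1_pdf (alpha%:num * n%:R) w)%:E * \prod_(i < n)
    (slab_ratio kappa sigma2 t (tnth ths i) (X i omega) w)%:E))%E); last first.
  by apply: eq_integral => omega _; rewrite mul1e prod_EFin -EFinM.
have sr0 i y : 0 <= slab_ratio kappa sigma2 t (tnth ths i) y w by exact: slab_ratio_ge0.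
have msr i : measurable_fun [set: R] (fun y => slab_ratio kappa sigma2 t (tnth ths i) y w).
  rewrite /slab_ratio; case: (tnth ths i == 0); last exact: measurable_expR_sqr.
  apply: measurable_funD => //; apply: measurable_funM => //.
  by apply: measurableT_comp => //; apply: measurable_funM => //; exact: measurable_funX.
rewrite ge0_integralZl//; last 3 first.
- apply: emeasurable_prod => i; apply/measurable_EFinP.
  exact: (measurableT_comp (msr i)).
- by move=> omega _; apply: prode_ge0 => i _; rewrite lee_fin.
- by rewrite lee_fin beta1_pdf_ge0.
rewrite (expectation_prod_normal indep normal
  (g := fun i y => (slab_ratio kappa sigma2 t (tnth ths i) y w)%:E))//; last first.
  by move=> i; apply/measurable_EFinP.
rewrite [leRHS]EFinM; apply: lee_pmul.
- by rewrite lee_fin beta1_pdf_ge0.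
- by apply: prode_ge0 => i _; apply: integral_ge0 => y _; rewrite lee_fin.
(* The exponent [alpha * n - 1] is nonnegative here. The endpoint [w = 0] is treated apart, its
   power being [0] or [1] by definition. *)
- rewrite lee_fin /beta1_pdf ler_piMr//.
  have /andP[] := w01; rewrite le_eqVlt => /predU1P[<- _|w0 w1].
    by rewrite /powR eqxx; case: (_ == 0).
  by rewrite -[leRHS](powRr0 w); apply: ger_powR; rewrite ?w0 ?subr_ge0.
apply: (@le_trans _ _ (\prod_(i < n) (if tnth ths i == 0 then 1 else 2)%R%:E)%E).
  apply: lee_prod => i _; apply/andP; split.
    by apply: integral_ge0 => y _; rewrite lee_fin.
  exact: slab_ratio_expectation_le.
by rewrite prod_EFin (prod_sparse _ _ hs) expr1n mul1r.
Qed.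

(** * The posterior mass of the bad set as a quotient *)

(** The lower bound of [spike_pattern_integral_ge], hence a lower bound for the denominator in units
    of the product of the [null_scale]. *)
Definition evidence_bound (R : realType) (alpha kappa sigma2 : R) (n s : nat) : R :=
  alpha * s%:R * expR (- (4 * (alpha + 1) * s%:R)) *
    (s%:R / n%:R * (Num.sqrt (1 + kappa * sigma2))^-1) ^+ s.

Lemma evidence_bound_gt0 (R : realType) (alpha kappa sigma2 : R) (n s : nat) :
  0 < alpha -> 0 <= kappa -> 0 < sigma2 -> (0 < s)%N -> (0 < n)%N ->
  0 < evidence_bound alpha kappa sigma2 n s.
Proof.
move=> a0 k0 s20 s0 n0; rewrite !mulr_gt0 ?expR_gt0 ?ltr0n//.
rewrite exprn_gt0// mulr_gt0 ?divr_gt0 ?ltr0n// invr_gt0 sqrtr_gt0.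
by rewrite ltr_pwDl// mulr_ge0// ltW.
Qed.

Lemma eb_posterior_le (R : realType) (n s : nat) (alpha : {posnum R})
    (kappa sigma2 t r : R) (x ths : n.-tuple R) :
  sparse s ths -> (0 < s)%N -> (4 * s <= n)%N ->
  0 <= kappa -> 0 <= t -> 4 * t <= kappa -> 0 < sigma2 ->
  ((eb_posterior alpha kappa sigma2 x [set u | r < l2dist u ths ^+ 2])%:E <=
   (expR (- (t * r)) / evidence_bound alpha%:num kappa sigma2 n s)%:E *
   \int[lebesgue_measure]_(w in `]0%R, 1%R[)
     (beta1_pdf (alpha%:num * n%:R) w *
      \prod_(i < n) slab_ratio kappa sigma2 t (tnth ths i) (tnth x i) w)%:E)%E.
Proof.
move=> hs s0 sn k0 t0 tk s20.
have n0 : (0 < n)%N by rewrite (leq_trans _ sn)// muln_gt0.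
set J := evidence_bound _ _ _ _ _.
have J0 : 0 < J by exact: evidence_bound_gt0.
set Z := (\int[lebesgue_measure]_(w in _) _)%E.
have Z0 : (0 <= Z)%E.
  apply: integral_ge0 => w; rewrite /= in_itv/= => /andP[/ltW w0 /ltW w1].
  rewrite lee_fin mulr_ge0 ?beta1_pdf_ge0//.
  by apply: prodr_ge0 => i _; apply: slab_ratio_ge0; rewrite w0.
have e0 : 0 < expR (- (t * r)) by exact: expR_gt0.
pose E := \prod_(i < n) null_scale kappa (tnth ths i) (tnth x i).
have E0 : 0 < E by apply: prodr_gt0 => i _; exact: null_scale_gt0.
have := @eb_numerator_le R n alpha kappa sigma2 t r x ths t0 tk s20.
have := @eb_denominator_ge R n alpha kappa sigma2 x ths k0 s20.
rewrite -/E -/Z /eb_posterior /Rintegral.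
set D := (\int[eb_prior _ _ _]_theta _)%E.
set N := (\int[eb_prior _ _ _]_(theta in _) _)%E.
move=> hD hN.
have {}hD : ((E * J)%:E <= D)%E.
  apply: le_trans hD; rewrite EFinM lee_wpmul2l ?lee_fin ?(ltW E0)//.
  exact: spike_pattern_integral_ge.
have [Dfin|] := boolP (D \is a fin_num); last first.
  rewrite ge0_fin_numE ?(le_trans _ hD) ?lee_fin ?mulr_ge0 ?(ltW E0) ?(ltW J0)//.
  rewrite -leNgt leye_eq => /eqP ->.
  by rewrite /= invr0 mulr0 mule_ge0// lee_fin divr_ge0 ?(ltW e0) ?(ltW J0).
have [Zfin|] := boolP (Z \is a fin_num); last first.
  rewrite ge0_fin_numE// -leNgt leye_eq => /eqP ->.
  by rewrite gt0_muley ?leey// lte_fin divr_gt0.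
have N0 : (0 <= N)%E by apply: integral_ge0 => theta _; rewrite lee_fin powR_ge0.
have Nfin : N \is a fin_num.
  rewrite ge0_fin_numE// (le_lt_trans hN)// -(fineK Zfin) -EFinM ltry.
  by [].
rewrite -(fineK Zfin) -EFinM lee_fin.
move: hD hN; rewrite -(fineK Dfin) -(fineK Nfin) -(fineK Zfin) -EFinM !lee_fin /=.
set D' := fine D; set N' := fine N; set Z' := fine Z => hD hN.
have EJ0 : 0 < E * J by exact: mulr_gt0.
have D'0 : 0 < D' by exact: lt_le_trans hD.
rewrite ler_pdivrMr//; apply: (le_trans hN).
have -> : expR (- (t * r)) * E * Z' = expR (- (t * r)) / J * Z' * (E * J).
  by field; rewrite gt_eqF.
apply: ler_wpM2l => //.
by rewrite mulr_ge0 ?divr_ge0 ?(ltW e0) ?(ltW J0)// -lee_fin fineK.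
Qed.

(** * Summability, and the choice of the tilt and of the rate *)

(** Telescoping: [1 / (k + 2) ^ 2 <= 1 / (k + 1) - 1 / (k + 2)]. *)
Lemma sum_inv_sqr_le (R : realFieldType) (m : nat) :
  \sum_(0 <= k < m) (k.+2%:R ^+ 2)^-1 <= 1 - m.+1%:R^-1 :> R.
Proof.
elim: m => [|m IH]; first by rewrite big_nil invr1 subrr.
rewrite big_nat_recr//=; apply: (le_trans (lerD IH (lexx _))).
have m1 : 0 < m.+1%:R :> R by rewrite ltr0n.
have m2 : 0 < m.+2%:R :> R by rewrite ltr0n.
have mE : m.+2%:R = m.+1%:R + 1 :> R by rewrite -natr1.
rewrite -subr_ge0 mE in m2 *.
rewrite [leRHS](_ : _ = (m.+1%:R * (m.+1%:R + 1) ^+ 2)^-1); last first.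
  by field; rewrite !gt_eqF.
by rewrite invr_ge0 mulr_ge0 ?sqr_ge0 ?ltW.
Qed.

(** The series of the majorants [W n] has finite integral, hence is finite almost everywhere; there
    the series of the [Q n] converges and its terms tend to [0]. *)
Lemma ae_cvg0_summable (R : realType) (d : measure_display) (T : measurableType d)
    (P : {measure set T -> \bar R}) (N : nat) (Q : nat -> T -> R)
    (W : nat -> T -> \bar R) :
  (2 <= N)%N -> (forall n, (N <= n)%N -> measurable_fun [set: T] (W n)) ->
  (forall n x, (N <= n)%N -> 0 <= Q n x) ->
  (forall n x, (N <= n)%N -> ((Q n x)%:E <= W n x)%E) ->
  (forall n, (N <= n)%N -> (\int[P]_x W n x <= ((n%:R ^+ 2)^-1)%:E)%E) ->
  {ae P, forall x, Q n x @[n --> \oo] --> (0 : R)}.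
Proof.
move=> N2 mW Q0 QW iW.
have Nk k : (N <= k + N)%N by exact: leq_addl.
pose V k := W (k + N)%N.
have V0 k x : (0 <= V k x)%E by apply: le_trans (QW _ _ (Nk k)); rewrite lee_fin Q0.
have mV k : measurable_fun [set: T] (V k) by exact: mW.
have mS : measurable_fun [set: T] (fun x => \sum_(k <oo) V k x)%E.
  exact: ge0_emeasurable_sum.
have S0 x : (0 <= \sum_(k <oo) V k x)%E by exact: nneseries_ge0.
have iS : (\int[P]_x \sum_(k <oo) V k x <= 1)%E.
  rewrite integral_nneseries//; apply: lime_le.
    by apply: is_cvg_nneseries => k _ _; exact: integral_ge0.
  apply: nearW => m.
  apply: (@le_trans _ _ (\sum_(0 <= k < m) ((k.+2%:R ^+ 2)^-1 : R)%:E)%E).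
    apply: lee_sum => k _; apply: (le_trans (iW _ (Nk k))).
    (* Since [2 <= N], the shifted index [k + N] is at least the [k + 2] of [sum_inv_sqr_le]. *)
    rewrite lee_fin lef_pV2 ?posrE ?exprn_gt0 ?ltr0n ?addn_gt0//; last first.
      by rewrite (leq_trans _ N2) ?orbT.
    by rewrite lerXn2r ?nnegrE ?ler0n// ler_nat -addn2 leq_add2l.
  rewrite sumEFin lee_fin; apply: (le_trans (sum_inv_sqr_le _ _)).
  by rewrite gerBl invr_ge0.
have intS : P.-integrable [set: T] (fun x => \sum_(k <oo) V k x)%E.
  apply/integrableP; split => //.
  under eq_integral do rewrite gee0_abs//.
  exact: le_lt_trans iS (ltry _).
have := integrable_ae measurableT intS; apply: filterS => x /(_ I) fin.
rewrite -(cvg_shiftn N).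
apply: cvg_series_cvg_0; apply: nondecreasing_is_cvgn.
  apply/nondecreasing_seqP => m; rewrite /series/= big_nat_recr//= lerDl.
  exact: Q0.
exists (fine (\sum_(k <oo) V k x)%E) => _ [m _ <-].
rewrite -lee_fin fineK// /series/= -sumEFin.
apply: (@le_trans _ _ (\sum_(0 <= k < m) V k x)%E).
  by apply: lee_sum => k _; exact: QW.
exact: nneseries_lim_ge.
Qed.

(** At [t = 0] the last inequality has slack [kappa * (sigma2 * (1 - kappa) - 1) > 0]. With
    [e = 4 * t] the slack changes by [- e * (1 + sigma2) + e ^+ 2 * sigma2], and [u] is the value of
    [e] at which the linear loss uses it up. *)
Lemma tilt_exists (R : realFieldType) (kappa sigma2 : R) :
  0 < kappa -> kappa < 1 -> 0 < sigma2 -> 1 < sigma2 * (1 - kappa) ->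
  exists t, [/\ 0 < t, 4 * t <= 3 / 4, 4 * t < 1 - kappa, 4 * t <= kappa &
    1 <= (1 + (kappa - 4 * t) * sigma2) * (1 - kappa - 4 * t)].
Proof.
move=> k0 k1 s0 ks.
pose u := kappa * (sigma2 * (1 - kappa) - 1) / (1 + sigma2).
have u0 : 0 < u by rewrite divr_gt0 ?mulr_gt0//; lra.
pose e := Num.min (Num.min (3 / 4) ((1 - kappa) / 2)) (Num.min kappa u).
have e0 : 0 < e by rewrite !lt_min u0 k0 !divr_gt0//; lra.
have e1 : e <= 3 / 4 by rewrite !ge_min lexx.
have e2 : e <= (1 - kappa) / 2 by rewrite !ge_min lexx orbT.
have e3 : e <= kappa by rewrite !ge_min lexx !orbT.
have e4 : e * (1 + sigma2) <= kappa * (sigma2 * (1 - kappa) - 1).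
  by rewrite -ler_pdivlMr ?ge_min ?lexx ?orbT//; lra.
exists (e / 4); rewrite [4 * _]mulrC divfK ?pnatr_eq0//.
split=> //; first by rewrite divr_gt0.
  by lra.
rewrite -subr_ge0.
rewrite [leRHS](_ : _ = kappa * (sigma2 * (1 - kappa) - 1) - e * (1 + sigma2)
  + e ^+ 2 * sigma2); last by ring.
by rewrite addr_ge0 ?subr_ge0// mulr_ge0 ?sqr_ge0// ltW.
Qed.

(** With [L = ln (n / s)]: [ln n = ln s + L <= s - 1 + L <= s * L], the last step being
    [0 <= (s - 1) * (L - 1)]. Exponential decay in the rate thus gives polynomial decay in [n]. *)
Lemma ln_le_rate (R : realType) (n s : nat) :
  (0 < s)%N -> (0 < n)%N -> 1 <= ln (n%:R / s%:R : R) ->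
  ln (n%:R : R) <= s%:R * ln (n%:R / s%:R).
Proof.
move=> s0 n0; set L := ln _ => L1.
have sR : 0 < s%:R :> R by rewrite ltr0n.
have nR : 0 < n%:R :> R by rewrite ltr0n.
have s1 : 1 <= s%:R :> R by rewrite ler1n.
have -> : ln (n%:R : R) = ln (s%:R : R) + L.
  by rewrite -lnM ?posrE ?divr_gt0// mulrC divfK// gt_eqF.
have ls : ln (s%:R : R) <= s%:R - 1.
  have := @le_ln1Dx R (s%:R - 1); rewrite subrKC; apply; lra.
have := mulr_ge0 (_ : 0 <= s%:R - 1) (_ : 0 <= L - 1).
rewrite !subr_ge0 => /(_ s1 L1); lra.
Qed.

(** The cost per support coordinate: [ln 2] from the moment bound [2 ^+ s], the other two terms from
    [evidence_bound]. *)
Definition rate_const (R : realType) (alpha kappa sigma2 : R) : R :=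
  ln 2 + 4 * (alpha + 1) + ln (Num.sqrt (1 + kappa * sigma2)).

Lemma rate_const_ge0 (R : realType) (alpha kappa sigma2 : R) :
  0 < alpha -> 0 <= kappa -> 0 < sigma2 -> 0 <= rate_const alpha kappa sigma2.
Proof.
move=> a0 k0 s20; rewrite !addr_ge0 ?ln_ge0 ?mulr_ge0 ?addr_ge0 ?(ltW a0)// ?ler1n//.
by rewrite -[leLHS]sqrtr1 ler_sqrt ?lerDl ?addr_ge0 ?mulr_ge0// ltW.
Qed.

(** Written as one exponential, with [L = ln (n / s)], the costs are [rate_const * s], then [s * L]
    from [(s / n) ^+ s], then [L] from [n / s]. They use up [rate_const + 2] multiples of [s * L];
    the two left over beat [2 * ln n] by [ln_le_rate]. *)
Lemma rate_bound (R : realType) (alpha kappa sigma2 : R) (n s : nat) :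
  0 < alpha -> 0 <= kappa -> 0 < sigma2 -> (0 < s)%N -> (0 < n)%N ->
  1 <= ln (n%:R / s%:R : R) ->
  expR (- ((rate_const alpha kappa sigma2 + 4) * (s%:R * ln (n%:R / s%:R)))) /
    evidence_bound alpha kappa sigma2 n s * (alpha * n%:R * 2 ^+ s) <=
  (n%:R ^+ 2)^-1.
Proof.
move=> a0 k0 s20 s0 n0 L1.
have LL := ln_le_rate s0 n0 L1.
set L := ln _ in L1 LL *.
have C0 := rate_const_ge0 a0 k0 s20.
pose q := Num.sqrt (1 + kappa * sigma2).
have q0 : 0 < q by rewrite sqrtr_gt0 ltr_pwDl// mulr_ge0// ltW.
have sR : 0 < s%:R :> R by rewrite ltr0n.
have nR : 0 < n%:R :> R by rewrite ltr0n.
have s1 : 1 <= s%:R :> R by rewrite ler1n.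
set C := rate_const _ _ _ in C0 *.
have eL : expR L = n%:R / s%:R by rewrite lnK// posrE divr_gt0.
have nE : n%:R = s%:R * expR L :> R.
  by rewrite eL mulrC divfK// gt_eqF.
have bE : s%:R / n%:R / q = expR (- L - ln q).
  by rewrite expRD !expRN eL lnK ?posrE// invf_div.
have twoE : 2 ^+ s = expR (s%:R * ln 2) :> R by rewrite expRM_natl lnK ?posrE.
have rE : (n%:R ^+ 2)^-1 = expR (- (2 * ln n%:R)) :> R.
  by rewrite expRN expRM_natl lnK ?posrE.
rewrite /evidence_bound -/q bE twoE rE -expRM_natl [X in _ * (alpha * X * _)]nE.
rewrite [leLHS](_ : _ = expR (- ((C + 4) * (s%:R * L)) + 4 * (alpha + 1) * s%:R -
  s%:R * (- L - ln q) + L + s%:R * ln 2)); last first.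
  rewrite !expRD !expRN; field.
  by rewrite !gt_eqF ?expR_gt0.
rewrite ler_expR.
have h1 : L <= s%:R * L by rewrite ler_peMl//; lra.
have h2 : C * s%:R <= C * (s%:R * L) by rewrite ler_wpM2l// ler_peMr// ltW.
have h3 : C * s%:R = 4 * (alpha + 1) * s%:R + s%:R * ln q + s%:R * ln 2.
  by rewrite /C /rate_const -/q; ring.
have h4 : (C + 4) * (s%:R * L) = C * (s%:R * L) + 4 * (s%:R * L) by ring.
rewrite h4 mulrBr mulrN; lra.
Qed.

End concentration.

Theorem theorem1 (R : realType) (alpha : {posnum R}) (beta kappa sigma2 : R)
    (beta_gt1 : 1 < beta) (kappa_gt0 : 0 < kappa) (kappa_lt1 : kappa < 1)
    (sigma2_gt0 : 0 < sigma2) (kappa_sigma2 : region_R beta kappa sigma2)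
    (s : nat -> nat) (theta_star : forall n : nat, n.-tuple R)
    (theta_sparse : forall n : nat, sparse (s n) (theta_star n))
    (s_infty : s n @[n --> \oo] --> \oo)
    (s_littleo : (s n)%:R / n%:R @[n --> \oo] --> (0 : R))
    (d : measure_display) (Omega : measurableType d) (P : probability Omega R)
    (X : forall n : nat, 'I_n -> {RV P >-> R})
    (X_indep : forall n : nat, mutually_independent (X n))
    (X_normal : forall (n : nat) (i : 'I_n) (A : set R), measurable A ->
      distribution P (X n i) A = normal_prob (tnth (theta_star n) i) 1 A) :
  let eps (n : nat) : R := (s n)%:R * ln (n%:R / (s n)%:R) in
  let bad (M : R) (n : nat) : set (n.-tuple R) :=
    [set theta | l2dist theta (theta_star n) ^+ 2 > M * eps n] in
  exists M : R, 0 < M /\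
    {ae P, forall omega,
      eb_posterior alpha kappa sigma2 [tuple X n i omega | i < n] (bad M n)
        @[n --> \oo] --> (0 : R)}.
Proof.
move=> eps bad.
have slab := region_R_slab beta_gt1 kappa_gt0 kappa_lt1 sigma2_gt0 kappa_sigma2.
have [t [t0 t34 t1k tk key]] := tilt_exists kappa_gt0 kappa_lt1 sigma2_gt0 slab.
have a0 : 0 < alpha%:num := gt0 alpha.
pose C := rate_const alpha%:num kappa sigma2.
have C0 : 0 <= C by exact: rate_const_ge0 (ltW kappa_gt0) sigma2_gt0.
(* Makes the Markov exponent [t * M * eps n] equal to the [(C + 4) * eps n] of [rate_bound]. *)
pose M := (C + 4) / t.
exists M; split; first by rewrite divr_gt0// ltr_wpDl.
have tM n : t * (M * eps n) = (C + 4) * eps n.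
  by rewrite mulrA [t * M]mulrC divfK// gt_eqF.
have [N0 _ HN0] : \forall n \near \oo,
    [/\ (0 < s n)%N, (4 * s n <= n)%N, 1 <= ln (n%:R / (s n)%:R : R) &
        1 <= alpha%:num * n%:R].
  (* A ratio [s n / n] below [4^-1] gives [4 * s n <= n]; below [expR (-1)] it gives
     [1 <= ln (n / s n)]. *)
  have d0 : 0 < Num.min (4^-1) (expR (-1)) :> R by rewrite lt_min expR_gt0 invr_gt0 ltr0n.
  near=> n.
  have s0 : (0 < s n)%N by near: n; move/cvgnyPge : s_infty; exact.
  have n0 : (0 < n)%N by rewrite (leq_trans s0)// (sparse_le (theta_sparse n)).
  have sR : 0 < (s n)%:R :> R by rewrite ltr0n.
  have nR : 0 < n%:R :> R by rewrite ltr0n.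
  have : `|(s n)%:R / n%:R| < Num.min (4^-1) (expR (-1)) :> R.
    by near: n; move/cvgr0_norm_lt : s_littleo; exact.
  rewrite ger0_norm ?divr_ge0// lt_min => /andP[h1 h2].
  split=> //.
  - rewrite -(ler_nat R) natrM -ler_pdivlMl//.
    by rewrite -ler_pdivrMr// ltW.
  - rewrite -ler_expR lnK ?posrE ?divr_gt0// -invf_div -[leLHS]invrK -expRN.
    by rewrite lef_pV2 ?posrE ?divr_gt0 ?expR_gt0// ltW.
  - rewrite mulrC -ler_pdivrMr//; near: n; exact: nbhs_infty_ger.
pose N := maxn N0 2.
have HN n : (N <= n)%N -> [/\ (0 < s n)%N, (4 * s n <= n)%N,
    1 <= ln (n%:R / (s n)%:R : R), 1 <= alpha%:num * n%:R & (0 < n)%N].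
  rewrite geq_max => /andP[/HN0 [s0 sn L1 an] n2]; split=> //.
  exact: leq_trans n2.
pose Z n omega := (\int[lebesgue_measure]_(w in `]0%R, 1%R[)
  (beta1_pdf (alpha%:num * n%:R) w * \prod_(i < n)
    slab_ratio kappa sigma2 t (tnth (theta_star n) i) (X n i omega) w)%:E)%E.
pose B n := expR (- (t * (M * eps n))) / evidence_bound alpha%:num kappa sigma2 n (s n).
have B0 n : (N <= n)%N -> 0 < B n.
  move=> /HN[s0 sn L1 an n0]; rewrite divr_gt0 ?expR_gt0//.
  by apply: evidence_bound_gt0 => //; exact: ltW.
have ZP n : (N <= n)%N -> measurable_fun [set: Omega] (Z n) /\
    (\int[P]_omega Z n omega <= (alpha%:num * n%:R * 2 ^+ s n)%:E)%E.
  move=> /HN[s0 sn L1 an n0].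
  exact: (slab_ratio_moment (X_indep n) (X_normal n) (theta_sparse n) (ltW t0)).
have Z0 n omega : (0 <= Z n omega)%E.
  apply: integral_ge0 => w; rewrite /= in_itv/= => /andP[/ltW w0 /ltW w1].
  rewrite lee_fin mulr_ge0 ?beta1_pdf_ge0//.
  by apply: prodr_ge0 => i _; apply: slab_ratio_ge0; rewrite w0.
(* The majorant is the bound of [eb_posterior_le]: a deterministic factor [B n] times the random
   integral [Z n], whose mean is controlled by [slab_ratio_moment]. *)
apply: (@ae_cvg0_summable R d Omega P N _ (fun n omega => ((B n)%:E * Z n omega)%E)).
- by rewrite leq_max orbT.
- by move=> n /ZP[mZ _]; exact: emeasurable_funM.
- move=> n omega _; rewrite /eb_posterior divr_ge0//.
    by rewrite /Rintegral fine_ge0// integral_ge0// => u _; rewrite lee_fin powR_ge0.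
  by rewrite /Rintegral fine_ge0// integral_ge0// => u _; rewrite lee_fin powR_ge0.
- move=> n omega Nn; have [s0 sn L1 an n0] := HN _ Nn.
  have := @eb_posterior_le R n (s n) alpha kappa sigma2 t (M * eps n)
    [tuple X n i omega | i < n] (theta_star n) (theta_sparse n) s0 sn
    (ltW kappa_gt0) (ltW t0) tk sigma2_gt0.
  move/le_trans; apply; apply: lee_wpmul2l; first by rewrite lee_fin; exact/ltW/B0.
  rewrite /Z le_eqVlt; apply/orP; left; apply/eqP; apply: eq_integral => w _.
  by congr (_ * _)%:E; apply: eq_bigr => i _; rewrite tnth_mktuple.
move=> n Nn; have [mZ iZ] := ZP _ Nn; have [s0 sn L1 an n0] := HN _ Nn.
rewrite ge0_integralZl//; last by rewrite lee_fin ltW// B0.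
apply: (@le_trans _ _ ((B n)%:E * (alpha%:num * n%:R * 2 ^+ s n)%:E)%E).
  by rewrite lee_wpmul2l// lee_fin ltW// B0.
rewrite -EFinM lee_fin /B tM.
exact: rate_bound (ltW kappa_gt0) sigma2_gt0 s0 n0 L1.
Unshelve. all: by end_near.
Qed.
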